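(* Let $P$ be an open disk with polar coordinates $(\rho,\theta)$, $0\le\rho<\pi/2$, $\theta\in[0,2\pi)$, and let $g=d\rho^2+\tan^2\rho\,d\theta^2$ be the exploding soliton metric on $P$. Let $S^1=\mathbb{R}/(2\pi\mathbb{Z})$ act isometrically on $(P,g)\times S^1(1)$ by $\tau\cdot(\rho,\theta,s)=(\rho,\theta+\tau,s+\tau)$, and identify $P$ with the quotient $[P\times S^1(1)]/S^1$ by the diffeomorphism $(\rho,\theta)\mapsto[\rho,\theta,0]$. Then the quotient metric on $P$ is $$\Upsilon(g)=d\rho^2+\sin^2\rho\,d\theta^2,$$ which is the standard metric on the (open) upper hemisphere of the unit sphere $S^2(1)$.
   Context: $S^1(r)=\mathbb{R}/(2\pi r\mathbb{Z})$ is the circle of radius $r$, with coordinate $s\in[0,2\pi)$ and metric $r^2ds^2$. Products carry the product metric. The quotient metric on the quotient of a Riemannian manifold by a free isometric action of a compact Lie group is the unique metric making the projection a Riemannian submersion. $\Upsilon(g)$ denotes the metric on $P$ obtained from a rotationally symmetric metric $g$ by the quotient construction described in the claim (radius $1$). The exploding soliton is the incomplete rotationally symmetric metric $d\rho^2+\tan^2\rho\,d\theta^2$, $0\le\rho<\pi/2$, a steady gradient Ricci soliton. *)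

(* Defs.v *)
From HB Require Import structures.
From mathcomp Require Import all_boot all_order all_algebra.
From mathcomp Require Import generic_quotient ring_quotient.
From mathcomp Require Import all_classical all_reals all_analysis.

Set Implicit Arguments.
Unset Strict Implicit.
Unset Printing Implicit Defensive.

Import Order.TTheory GRing.Theory Num.Theory.
Import numFieldNormedType.Exports.

Local Open Scope classical_set_scope.
Local Open Scope ring_scope.
Local Open Scope quotient_scope.

Section Smooth.
Context {R : realType} {V W : normedModType R}.

Fixpoint Ck (k : nat) (U : set V) (f : V -> W) : Prop :=
  match k with
  | 0 => forall x, U x -> {for x, continuous f}
  | k'.+1 => (forall x, U x -> differentiable f x) /\
             forall v : V, Ck k' U ('D_v f)
  end.

Definition smooth_on (U : set V) (f : V -> W) : Prop := forall k, Ck k U f.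

End Smooth.

(* A manifold is given by its underlying set [pts] and a family of local
   parametrizations [par i : dom i -> pts] with [dom i] in R^n.  The conditions
   they must satisfy are in [is_manifold]. *)
Record manifold (R : realType) (n : nat) (T : Type) := Manifold {
  pts : set T;
  idx : Type;
  dom : idx -> set 'rV[R]_n;
  par : idx -> 'rV[R]_n -> T }.

Section Manifolds.
Context {R : realType}.

(* F is the expression, near a, of f in the parametrizations i and j. *)
Definition local_rep {m n : nat} {T T' : Type}
    (M : manifold R m T) (N : manifold R n T') (f : T -> T')
    (i : idx M) (a : 'rV[R]_m) (j : idx N) (F : 'rV[R]_m -> 'rV[R]_n) : Prop :=
  exists U : set 'rV[R]_m,
    [/\ open U, U a, U `<=` dom i, smooth_on U F &
        forall x, U x -> dom j (F x) /\ par j (F x) = f (par i x)].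

Definition smooth_map {m n : nat} {T T' : Type}
    (M : manifold R m T) (N : manifold R n T') (f : T -> T') : Prop :=
  (forall p, pts M p -> pts N (f p)) /\
  forall (i : idx M) a (j : idx N) b,
    dom i a -> dom j b -> par j b = f (par i a) ->
    exists F, local_rep f i a j F.

Definition manifold_open {n : nat} {T : Type} (M : manifold R n T)
    (O : set T) : Prop :=
  forall i : idx M, open (dom i `&` par i @^-1` O).

(* [smooth_map M M id] says that the domains of the changes of parametrization
   are open and that these changes are smooth.  Second countability is stated
   as the existence of a countable subatlas. *)
Definition is_manifold {n : nat} {T : Type} (M : manifold R n T) : Prop :=
  [/\ forall i : idx M, open (dom i) /\ set_inj (dom i) (par i),
      pts M = \bigcup_(i in [set: idx M]) (par i @` dom i),
      smooth_map M M id,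
      forall p q, pts M p -> pts M q -> p <> q ->
        exists O O' : set T,
          [/\ manifold_open M O, manifold_open M O', O p, O' q &
              O `&` O' `&` pts M = set0] &
      exists J : set (idx M),
        countable J /\ pts M `<=` \bigcup_(i in J) (par i @` dom i)].

Definition diffeo {m n : nat} {T T' : Type}
    (M : manifold R m T) (N : manifold R n T') (f : T -> T') : Prop :=
  smooth_map M N f /\
  exists f' : T' -> T,
    [/\ smooth_map N M f', forall p, pts M p -> f' (f p) = p &
        forall q, pts N q -> f (f' q) = q].

(* The Gram matrices of a metric in the coordinates given by each
   parametrization. *)
Definition metric {n : nat} {T : Type} (M : manifold R n T) : Type :=
  idx M -> 'rV[R]_n -> 'M[R]_n.

Definition inner {n : nat} {T : Type} {M : manifold R n T} (g : metric M)
    (i : idx M) (a v w : 'rV[R]_n) : R :=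
  (v *m g i a *m w^T) 0 0.

Definition preserves {m n : nat} {T T' : Type}
    {M : manifold R m T} (g : metric M) {N : manifold R n T'} (h : metric N)
    (f : T -> T') : Prop :=
  forall i a j F, local_rep f i a j F ->
    forall v w, inner g i a v w = inner h j (F a) ('d F a v) ('d F a w).

(* [preserves g g id] is the compatibility of the Gram matrices with the
   changes of parametrization. *)
Definition riemannian {n : nat} {T : Type} (M : manifold R n T) (g : metric M)
    : Prop :=
  [/\ is_manifold M,
      forall i, smooth_on (dom i) (g i),
      forall i a, dom i a -> (g i a)^T = g i a,
      forall i a v, dom i a -> v != 0 -> 0 < inner g i a v v &
      preserves g g id].

Definition riem_isometry {m n : nat} {T T' : Type}
    (M : manifold R m T) (g : metric M) (N : manifold R n T') (h : metric N)
    (f : T -> T') : Prop :=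
  [/\ riemannian g, riemannian h, diffeo M N f & preserves g h f].

Definition submersion {m n : nat} {T T' : Type}
    (M : manifold R m T) (N : manifold R n T') (f : T -> T') : Prop :=
  smooth_map M N f /\
  forall (i : idx M) a (j : idx N) F, local_rep f i a j F ->
    forall w : 'rV[R]_n, exists v : 'rV[R]_m, 'd F a v = w.

Definition riemannian_submersion {m n : nat} {T T' : Type}
    (M : manifold R m T) (g : metric M) (N : manifold R n T') (h : metric N)
    (f : T -> T') : Prop :=
  submersion M N f /\
  forall (i : idx M) a (j : idx N) F, local_rep f i a j F ->
    let horizontal v := forall u, 'd F a u = 0 -> inner g i a u v = 0 in
    forall v w, horizontal v -> horizontal w ->
      inner h j (F a) ('d F a v) ('d F a w) = inner g i a v w.

Definition prod_manifold {m n : nat} {T T' : Type}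
    (M : manifold R m T) (N : manifold R n T') : manifold R (m + n) (T * T') :=
  @Manifold R (m + n) (T * T')%type (pts M `*` pts N) (idx M * idx N)%type
    (fun ij => [set x | dom ij.1 (lsubmx x) /\ dom ij.2 (rsubmx x)])
    (fun ij x => (par ij.1 (lsubmx x), par ij.2 (rsubmx x))).

Definition prod_metric {m n : nat} {T T' : Type}
    {M : manifold R m T} (g : metric M) {N : manifold R n T'} (h : metric N)
    : metric (prod_manifold M N) :=
  fun ij x => block_mx (g ij.1 (lsubmx x)) 0 0 (h ij.2 (rsubmx x)).

Definition induced_metric {n k : nat} (M : manifold R n 'rV[R]_k) : metric M :=
  fun i a => 'J (par i) a *m ('J (par i) a)^T.

End Manifolds.

Arguments induced_metric {R n k} M _ _.

Section Circle.
Variable R : realType.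

Definition period : {pred R} :=
  [pred x : R | `[< exists k : int, x = k%:~R * (2 * pi) >]].

Lemma period_zmod_closed : zmod_closed period.
Proof.
split; first by apply/asboolP; exists 0; rewrite mul0r.
move=> x y /asboolP[k ->] /asboolP[l ->]; apply/asboolP; exists (k - l).
by rewrite intrB mulrBl.
Qed.

HB.instance Definition _ := GRing.isZmodClosed.Build R period period_zmod_closed.

(* The group R / 2 pi Z. *)
Definition S1 : zmodType := Quotient.quot period.

Definition to_S1 (s : R) : S1 := \pi_(Quotient.quot period) s.

Definition of_S1 (s : S1) : R := repr (s : Quotient.quot period).

Definition circle : manifold R 1 S1 :=
  @Manifold R 1 S1 [set: S1] R
    (fun c => [set x | c < x 0 0 < c + 2 * pi])
    (fun _ x => to_S1 (x 0 0)).

(* The circle S^1(r), with metric r^2 ds^2 in the coordinate s of period 2 pi. *)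
Definition circle_metric (r : R) : metric circle := fun _ _ => (r ^+ 2)%:M.

End Circle.

Section CircleAction.
Context {R : realType} {n : nat} {T : Type}.
Variables (M : manifold R n T) (g : metric M) (act : S1 R -> T -> T).

Definition free_isometric_action : Prop :=
  [/\ smooth_map (prod_manifold (circle R) M) M (fun z => act z.1 z.2),
      forall p, pts M p -> act 0 p = p,
      forall s t p, pts M p -> act (s + t) p = act s (act t p),
      forall s, riem_isometry g g (act s) &
      forall s p, pts M p -> act s p = p -> s = 0].

Definition act_orbit (p : T) : set T := range (act^~ p).

(* Q is the orbit space with the smooth structure of the quotient. *)
Definition quotient_manifold {k : nat} (Q : manifold R k (set T)) : Prop :=
  [/\ is_manifold Q, pts Q = act_orbit @` pts M & submersion M Q act_orbit].

Definition quotient_metric {k : nat} (Q : manifold R k (set T)) (q : metric Q)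
    : Prop :=
  [/\ quotient_manifold Q, riemannian q & riemannian_submersion g q act_orbit].

End CircleAction.

Section Disk.
Variable R : realType.

Definition row2 (a b : R) : 'rV[R]_2 := \row_j [:: a; b]`_j.
Definition row3 (a b c : R) : 'rV[R]_3 := \row_j [:: a; b; c]`_j.

(* The library's norm on 'rV is the sup norm. *)
Definition enorm {n : nat} (x : 'rV[R]_n) : R :=
  Num.sqrt (\sum_i x 0 i ^+ 2).

Definition polar (rho theta : R) : 'rV[R]_2 :=
  row2 (rho * cos theta) (rho * sin theta).

(* The open disk 0 <= rho < pi / 2. *)
Definition disk : manifold R 2 'rV[R]_2 :=
  @Manifold R 2 'rV[R]_2 [set x | enorm x < pi / 2] unit
    (fun _ => [set x | enorm x < pi / 2]) (fun _ => id).

(* drho = (x dx + y dy) / rho and dtheta = (x dy - y dx) / rho^2, as rows of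
   coefficients on dx, dy. *)
Definition drho (x : 'rV[R]_2) : 'rV[R]_2 := (enorm x)^-1 *: x.
Definition dtheta (x : 'rV[R]_2) : 'rV[R]_2 :=
  (enorm x ^+ 2)^-1 *: row2 (- x 0 1) (x 0 0).

(* drho^2 + f(rho)^2 dtheta^2.  At the pole, where drho and dtheta are
   undefined, the value is that of the continuous extension when f(0) = 0 and
   f'(0) = 1. *)
Definition rot_metric (f : R -> R) : metric disk := fun _ x =>
  if x == 0 then 1%:M
  else (drho x)^T *m drho x
       + f (enorm x) ^+ 2 *: ((dtheta x)^T *m dtheta x).

Definition rotation (t : R) (x : 'rV[R]_2) : 'rV[R]_2 :=
  row2 (cos t * x 0 0 - sin t * x 0 1) (sin t * x 0 0 + cos t * x 0 1).

Definition disk_circle : manifold R (2 + 1) ('rV[R]_2 * S1 R) :=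
  prod_manifold disk (circle R).

(* tau . (rho, theta, s) = (rho, theta + tau, s + tau) *)
Definition diag_action (tau : S1 R) (p : 'rV[R]_2 * S1 R) : 'rV[R]_2 * S1 R :=
  (rotation (of_S1 tau) p.1, p.2 + tau).

(* (rho, theta) |-> [rho, theta, 0] *)
Definition to_quotient (x : 'rV[R]_2) : set ('rV[R]_2 * S1 R) :=
  act_orbit diag_action (x, 0).

(* h = Upsilon(g): the quotient metric of (disk, g) x S^1(1) by the diagonal
   action, carried to the disk by [to_quotient]. *)
Definition is_Upsilon (g h : metric disk) : Prop :=
  let gM : metric disk_circle := prod_metric g (circle_metric (1 : R)) in
  (exists Q : manifold R 2 (set ('rV[R]_2 * S1 R)),
     quotient_manifold disk_circle diag_action Q) /\
  forall Q : manifold R 2 (set ('rV[R]_2 * S1 R)),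
    quotient_manifold disk_circle diag_action Q ->
    [/\ diffeo disk Q to_quotient,
        exists q : metric Q, quotient_metric gM diag_action q &
        forall q : metric Q, quotient_metric gM diag_action q ->
          riem_isometry h q to_quotient].

(* The open upper hemisphere of the unit sphere of R^3, parametrized as a graph
   over the unit disk. *)
Definition hemisphere : manifold R 2 'rV[R]_3 :=
  @Manifold R 2 'rV[R]_3 [set y | enorm y = 1 /\ 0 < y 0 2] unit
    (fun _ => [set u | enorm u < 1])
    (fun _ u => row3 (u 0 0) (u 0 1) (Num.sqrt (1 - enorm u ^+ 2))).

End Disk.

(* Main.v *)
From HB Require Import structures.
Require Import Defs.
From mathcomp Require Import all_boot all_order all_algebra.
From mathcomp Require Import generic_quotient ring_quotient.
From mathcomp Require Import all_classical all_reals all_analysis.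
From mathcomp Require Import ring lra zify.
Import Order.TTheory GRing.Theory Num.Theory.
Import numFieldNormedType.Exports.
Set Implicit Arguments.
Unset Strict Implicit.
Unset Printing Implicit Defensive.
Local Open Scope classical_set_scope.
Local Open Scope ring_scope.

(** Write u = rho^2 and let J be the quarter turn of the plane, so that J x is
    the value at x of the rotation field d/dtheta.

    Smoothness at the pole.  In Cartesian coordinates a rotationally symmetric
    metric d rho^2 + f(rho)^2 d theta^2 is the flat metric plus the multiple
    (f^2 - u) / u^2 of the square of x dy - y dx ([rot_metricE]).  It is smooth
    across the pole as soon as f^2 = u (1 + u phi(u)) with phi smooth
    ([riemannian_rot_metric]).  For sin and tan, phi is built from the entire
    series cos (sqrt u) and sin (sqrt u) / sqrt u and from their difference
    quotients at 0 ([sin_profile], [tan_profile]).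

    The quotient.  Every orbit of the diagonal action meets the slice s = 0 in
    one point, so the orbit map is the composite of [to_quotient] with
    p (x, s) = R_(-s) x, where R_t is the rotation by t ([orbit_slice]).  The
    orbit direction at (x, s) is (J x, 1); hence (v, c) is horizontal exactly
    when c = - g (J x, v) ([horizontalP]), and d p sends it, up to the rotation
    R_(-s), to v + g (J x, v) J x.  With g (J x, v) = tan^2 rho d theta (v), the
    theta component of v is stretched by 1 + tan^2 rho, while the squared length
    of (v, c) is d rho (v)^2 + tan^2 rho (1 + tan^2 rho) d theta (v)^2.  The
    metric making d p isometric on horizontal vectors is therefore
    d rho^2 + tan^2 rho / (1 + tan^2 rho) d theta^2, that is,
    d rho^2 + sin^2 rho d theta^2 ([slice_horizontal_isometry]).

    Arbitrary models of the orbit space.  A model Q of the orbit space is only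
    known through its submersion from the product.  The chain rule applied to
    the factorization through p shows that [to_quotient] is a smooth bijection
    from the disk to Q with invertible differentials.  Its inverse is smooth by
    the inverse function theorem ([smooth_inverse], [bijective_smooth_diffeo]).
    The metric is carried to Q by [pushforward_metric], and a metric on Q is the
    quotient metric exactly when [to_quotient] is an isometry
    ([riemannian_submersion_of_preserves], [preserves_of_riemannian_submersion]).

    The hemisphere.  The map (sin rho cos theta, sin rho sin theta, cos rho) is
    again given by the two entire series in Cartesian coordinates.  That it
    preserves the metric follows from the first-order differential equations
    which they satisfy ([sphere_chart_isometry]); its inverse is smooth by the
    same inverse function theorem. *)

(** * Differentials *)

Section Differential.
Context {R : realType}.
Implicit Types V W : normedModType R.

(** The differential in epsilon form, without Landau notation: the form in
    which the inverse function theorem and the locality of differentials use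
    it. *)
Lemma is_diff_approx V W (f : V -> W) (x : V) (L : {linear V -> W}) :
  continuous L ->
  (forall e, 0 < e -> \forall y \near x,
     `|f y - f x - L (y - x)| <= e * `|y - x|) ->
  is_diff x f L.
Proof.
move=> cL fL.
have E : f \o shift x = cst (f x) + L +o_ 0 id.
  apply/eqaddoP => e e0.
  have /= := fL e e0; rewrite (near_shift 0 x) /= subr0.
  apply: filterS => y /=; rewrite addrK => h.
  apply: le_trans h; rewrite /shift /= /cst.
  by rewrite opprD addrA.
apply: DiffDef; last exact: diff_unique.
by apply/diff_locallyP; rewrite (diff_unique cL E); split.
Qed.

Lemma diff_approx V W (f : V -> W) (x : V) : differentiable f x ->
  forall e, 0 < e -> \forall y \near x,
     `|f y - f x - 'd f x (y - x)| <= e * `|y - x|.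
Proof.
move=> df e e0; have /eqaddoP /(_ e e0) := diff_locally df.
rewrite (near_shift 0 x) /= subr0; apply: filterS => y /=.
by rewrite addrK /cst /= opprD addrA.
Qed.

(** Differentiability is local: this is what allows a local representative
    to be replaced by an explicit formula. *)
Lemma near_eq_is_diff V W (f g : V -> W) (x : V) :
  (\forall y \near x, f y = g y) -> differentiable f x ->
  differentiable g x /\ 'd g x = 'd f x :> (V -> W).
Proof.
move=> fg df.
suff [? ?] : is_diff x g ('d f x) by split.
apply: is_diff_approx; first exact: diff_continuous.
move=> e e0; have fx := nbhs_singleton fg.
by have := diff_approx df e0; apply: filterS2 fg => y <-; rewrite fx.
Qed.

Lemma differentiable_mxP V m n (f : V -> 'M[R]_(m, n)) x :
  differentiable f x <-> forall i j, differentiable (fun y => f y i j) x.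
Proof.
split=> [df i j|df].
  exact: (differentiable_comp df (differentiable_coord _ i j)).
rewrite (_ : f = \sum_i \sum_j (fun y => f y i j *: delta_mx i j)).
  apply: differentiable_sum => i; apply: differentiable_sum => j.
  exact: differentiableZl.
apply/funext => y; rewrite {1}(matrix_sum_delta (f y)) fct_sumE.
by apply: eq_bigr => i _; rewrite fct_sumE.
Qed.

Lemma derive_mxE V m n (f : V -> 'M[R]_(m, n)) x v i j : differentiable f x ->
  ('D_v f x) i j = 'D_v (fun y => f y i j) x.
Proof. by move=> df; rewrite derive_mx ?mxE//; exact: diff_derivable. Qed.

Lemma diff_compE (U V W : normedModType R) (f : U -> V) (g : V -> W) x v :
  differentiable f x -> differentiable g (f x) ->
  'd (g \o f) x v = 'd g (f x) ('d f x v).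
Proof. by move=> df dg; rewrite diff_comp. Qed.

Lemma diff_idE (V : normedModType R) (a v : V) : 'd id a v = v.
Proof.
by rewrite -deriveE ?derive_id.
Qed.

Lemma derive_coord m n (a v : 'M[R]_(m, n)) i j :
  'D_v (fun x : 'M[R]_(m, n) => x i j) a = v i j.
Proof.
have d : differentiable (fun x : 'M[R]_(m, n) => x) a.
  exact: ex_diff.
by rewrite -(derive_mxE v i j d) derive_id.
Qed.

Lemma is_derive_coord m n (a v : 'M[R]_(m, n)) i j :
  is_derive a v (fun x : 'M[R]_(m, n) => x i j) (v i j).
Proof.
apply: DeriveDef; last exact: derive_coord.
exact/diff_derivable/differentiable_coord.
Qed.

Lemma is_derive_comp_real V (g : V -> R) (f : R -> R) a v dg df :
  differentiable g a -> is_derive a v g dg -> is_derive (g a) 1 f df ->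
  is_derive a v (fun x => f (g x)) (dg * df).
Proof.
move=> difg [_ <-] [fd <-]; have diff : differentiable f (g a).
  exact/derivable1_diffP.
have difc : differentiable (f \o g) a by exact: differentiable_comp.
apply: DeriveDef; first exact: (@diff_derivable _ _ _ (f \o g) a v difc).
rewrite -[X in 'D_v X a]/(f \o g) !deriveE// diff_compE//.
rewrite -[in LHS](mulr1 ('d g a v)).
exact: (linearZZ ('d f (g a)) ('d g a v) 1).
Qed.

Lemma diff_const_mx m (V : normedModType R) (phi : V -> R) (c : R) x v :
  differentiable phi x ->
  'd (fun x => const_mx (phi x + c) : 'rV[R]_m) x v = const_mx ('d phi x v).
Proof.
move=> dphi; have dc : differentiable (fun x => phi x + c) x.
  by apply: differentiableD => //; exact: differentiable_cst.
have dF : differentiable (fun x => const_mx (phi x + c) : 'rV[R]_m) x.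
  apply/differentiable_mxP => i j; rewrite (_ : (fun _ => _) = fun y => phi y + c)//.
  by apply/funext => y; rewrite mxE.
apply/matrixP => i j; rewrite -deriveE// derive_mxE// mxE.
rewrite (_ : (fun _ => _) = phi + cst c); last by apply/funext => y; rewrite mxE.
rewrite deriveD; [|exact: diff_derivable|exact: derivable_cst].
by rewrite derive_cst addr0 deriveE.
Qed.

Lemma diff_row_mx (V : normedModType R) m n (f : V -> 'rV[R]_m) (g : V -> 'rV[R]_n) x v :
  differentiable f x -> differentiable g x ->
  differentiable (fun x => row_mx (f x) (g x)) x /\
  'd (fun x => row_mx (f x) (g x)) x v = row_mx ('d f x v) ('d g x v).
Proof.
move=> df dg; have dfg : differentiable (fun x => row_mx (f x) (g x)) x.
  apply/differentiable_mxP => i j; case: (split_ordP j) => k ->.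
    rewrite (_ : (fun _ => _) = fun y => f y i k); last first.
      by apply/funext => y; rewrite row_mxEl.
    exact: (differentiable_mxP _ _).1 df i k.
  rewrite (_ : (fun _ => _) = fun y => g y i k); last first.
    by apply/funext => y; rewrite row_mxEr.
  exact: (differentiable_mxP _ _).1 dg i k.
split=> //; apply/matrixP => i j; rewrite -!deriveE// derive_mxE//.
case: (split_ordP j) => k ->.
  rewrite row_mxEl derive_mxE//; congr ('D_v _ x).
  by apply/funext => y; rewrite row_mxEl.
rewrite row_mxEr derive_mxE//; congr ('D_v _ x).
by apply/funext => y; rewrite row_mxEr.
Qed.

Lemma diff_lsubmx m n (x v : 'rV[R]_(m + n)) : 'd lsubmx x v = lsubmx v.
Proof. by rewrite diff_lin//; exact: continuous_lsubmx. Qed.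

Lemma diff_rsubmx m n (x v : 'rV[R]_(m + n)) : 'd rsubmx x v = rsubmx v.
Proof. by rewrite diff_lin//; exact: continuous_rsubmx. Qed.

End Differential.

(** * Smooth functions between normed modules *)

Section SmoothCalculus.
Context {R : realType}.
Implicit Types V W : normedModType R.

Lemma Ck_subset V W k (U U' : set V) (f : V -> W) :
  U' `<=` U -> Ck k U f -> Ck k U' f.
Proof.
move=> UU; elim: k f => [|k IH] f /=; first by move=> h x /UU/h.
by move=> [df h]; split=> [x /UU/df|v]; last exact/IH/h.
Qed.

(** Ck on a set is a pointwise condition at every order, so it passes to
    unions. *)
Lemma Ck_bigcup V W k I (D : set I) (U : I -> set V) (f : V -> W) :
  (forall i, D i -> Ck k (U i) f) -> Ck k (\bigcup_(i in D) U i) f.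
Proof.
elim: k f => [|k IH] f /= h; first by move=> x [i Di] /(h i Di).
split=> [x [i Di]|v]; first exact: (h i Di).1.
by apply: IH => i Di; exact: (h i Di).2.
Qed.

Lemma CkW V W k (U : set V) (f : V -> W) : Ck k.+1 U f -> Ck k U f.
Proof.
elim: k f => [|k IH] f [df h]; first by move=> x /df/differentiable_continuous.
by split=> // v; exact/IH/h.
Qed.

Lemma smooth_differentiable V W (U : set V) (f : V -> W) x :
  smooth_on U f -> U x -> differentiable f x.
Proof. by move=> /(_ 1)[+ _]; exact. Qed.

Lemma smooth_derive V W (U : set V) (f : V -> W) v :
  smooth_on U f -> smooth_on U ('D_v f).
Proof. by move=> h k; exact: (h k.+1).2. Qed.

Lemma smooth_subset V W (U U' : set V) (f : V -> W) :
  U' `<=` U -> smooth_on U f -> smooth_on U' f.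
Proof. by move=> UU h k; exact: Ck_subset (h k). Qed.

Lemma smooth_local V W (U : set V) (f : V -> W) :
  (forall x, U x -> exists U', U' x /\ smooth_on U' f) -> smooth_on U f.
Proof.
move=> h k; apply: (@Ck_subset _ _ _ (\bigcup_(A in smooth_on^~ f) A)).
  by move=> x /h[A [Ax fA]]; exists A.
by apply: Ck_bigcup => A /(_ k).
Qed.

Lemma near_open V (U : set V) x (P : V -> Prop) : open U -> U x ->
  (forall y, U y -> P y) -> \forall y \near x, P y.
Proof. by move=> oU Ux h; apply: filterS h _; exact: open_nbhs_nbhs. Qed.

Section OnOpen.
Context {V : normedModType R} (U : set V) (oU : open U).

(** Derivatives at a point of an open set see only the values on that set.
    Most closure properties below are proved on the formula for the
    derivative, which holds only on the set. *)
Lemma eq_Ck W k (f g : V -> W) :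
  (forall x, U x -> f x = g x) -> Ck k U f -> Ck k U g.
Proof.
elim: k f g => [|k IH] f g fg /=.
  move=> cf x Ux; have := cf x Ux; rewrite /prop_for /continuous_at -fg// => h.
  apply: cvg_trans h; apply: near_eq_cvg; exact: (near_open oU Ux).
move=> [df h]; split=> [x Ux|v].
  exact: (near_eq_is_diff (near_open oU Ux fg) (df x Ux)).1.
apply: IH (h v) => x Ux; apply: near_eq_derive; exact: (near_open oU Ux).
Qed.

Lemma eq_smooth W (f g : V -> W) :
  (forall x, U x -> f x = g x) -> smooth_on U f -> smooth_on U g.
Proof. by move=> fg h k; exact: eq_Ck (h k). Qed.

Lemma Ck_cst W k (a : W) : Ck k U (cst a).
Proof.
elim: k a => [|k IH] a /=; first by move=> x _; exact: cvg_cst.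
split=> // v; rewrite (_ : 'D_v _ = cst 0)//; apply/funext => x.
by rewrite derive_cst.
Qed.

Lemma Ck_linear W k (f : {linear V -> W}) : continuous f -> Ck k U f.
Proof.
move=> cf; case: k => [|k] /=; first by move=> x _; exact: cf.
split=> [x _|v]; first exact: linear_differentiable.
rewrite (_ : 'D_v _ = cst (f v)); first exact: Ck_cst.
by apply/funext => x; rewrite deriveE ?diff_lin//; exact: linear_differentiable.
Qed.

Lemma Ck_id k : Ck k U id.
Proof. by apply: (@Ck_linear _ k idfun) => x. Qed.

Lemma CkD W k (f g : V -> W) : Ck k U f -> Ck k U g -> Ck k U (f + g).
Proof.
elim: k f g => [|k IH] f g /=.
  by move=> cf cg x Ux; apply: continuousD; [exact: cf|exact: cg].
move=> [df hf] [dg hg]; split=> [x Ux|v].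
  by apply: differentiableD; [exact: df|exact: dg].
apply: eq_Ck (IH _ _ (hf v) (hg v)) => x Ux.
by rewrite deriveD//; apply: diff_derivable; [exact: df|exact: dg].
Qed.

Lemma CkN W k (f : V -> W) : Ck k U f -> Ck k U (- f).
Proof.
elim: k f => [|k IH] f /=.
  by move=> cf x Ux; apply: continuousN; exact: cf.
move=> [df hf]; split=> [x Ux|v].
  by apply: differentiableN; exact: df.
apply: eq_Ck (IH _ (hf v)) => x Ux.
by rewrite deriveN//; apply: diff_derivable; exact: df.
Qed.

(** Induction on k: the derivative f Dg + g Df is a sum of products of
    functions of class one less. *)
Lemma CkM k (f g : V -> R) : Ck k U f -> Ck k U g -> Ck k U (f * g).
Proof.
elim: k f g => [|k IH] f g.
  by move=> cf cg x Ux; apply: continuousM; [exact: cf|exact: cg].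
move=> hf hg; have [[df Df] [dg Dg]] := (hf, hg); split=> [x Ux|v].
  by apply: differentiableM; [exact: df|exact: dg].
apply: (@eq_Ck _ _ (f * 'D_v g + g * 'D_v f)) => [x Ux|].
  by rewrite deriveM//; apply: diff_derivable; [exact: df|exact: dg].
by apply: CkD; apply: IH; [exact: CkW hf|exact: Dg|exact: CkW hg|exact: Df].
Qed.

Lemma CkV k (f : V -> R) : (forall x, U x -> f x != 0) ->
  Ck k U f -> Ck k U (fun x => (f x)^-1).
Proof.
move=> f0; elim: k => [|k IH].
  by move=> cf x Ux; apply: continuousV; [exact: f0|exact: cf].
move=> hf; have [df Df] := hf; split=> [x Ux|v].
  by apply: differentiableV; [exact: df|exact: f0].
have hV := IH (CkW hf).
apply: (@eq_Ck _ _ (- ((fun x => (f x)^-1) * (fun x => (f x)^-1) * 'D_v f))).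
  move=> x Ux; rewrite deriveV ?f0//; last exact/diff_derivable/df.
  by rewrite expr2 invfM; symmetry; exact: mulNr.
by apply: CkN; apply: CkM; [exact: CkM|exact: Df].
Qed.

(** A derivative in a matrix space is computed entrywise, so smoothness
    reduces to real-valued functions. *)
Lemma Ck_mxP k m n (f : V -> 'M[R]_(m, n)) :
  Ck k U f <-> forall i j, Ck k U (fun x => f x i j).
Proof.
elim: k f => [|k IH] f.
  split=> [cf i j x Ux|cf x Ux].
    exact: (continuous_comp (cf x Ux) (@coord_continuous _ _ _ i j (f x))).
  rewrite /prop_for /continuous_at; apply/cvgrPdist_lt => e e0.
  have h : \forall y \near x, forall ij : 'I_m * 'I_n,
      `|f x ij.1 ij.2 - f y ij.1 ij.2| < e.
    apply: filter_forall => -[i j] /=.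
    by have /cvgrPdist_lt /(_ e e0) := cf i j x Ux.
  apply: filterS h => y h; rewrite /Num.Def.normr/= mx_normrE.
  by apply: bigmax_lt => // ij _; rewrite !mxE.
split=> [[df Df] i j|h].
  split=> [x Ux|v]; first exact: (differentiable_mxP _ _).1 (df x Ux) i j.
  apply: eq_Ck ((IH _).1 (Df v) i j) => x Ux.
  by rewrite derive_mxE//; exact: df.
have df x : U x -> differentiable f x.
  by move=> Ux; apply/differentiable_mxP => i j; exact: (h i j).1.
split=> // v; apply/IH => i j; apply: eq_Ck ((h i j).2 v) => x Ux.
by rewrite derive_mxE//; exact: df.
Qed.

Lemma Ck_sum W k I (r : seq I) (P : pred I) (f : I -> V -> W) :
  (forall i, P i -> Ck k U (f i)) ->
  Ck k U (fun x => \sum_(i <- r | P i) f i x).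
Proof.
move=> h; elim: r => [|i r IH].
  by apply: eq_Ck (Ck_cst k 0) => x _; rewrite big_nil.
have [Pi|Pi] := boolP (P i); last first.
  by apply: eq_Ck IH => x _; rewrite big_cons (negbTE Pi).
by apply: eq_Ck (CkD (h i Pi) IH) => x _; rewrite big_cons Pi.
Qed.

Lemma Ck_prod k I (r : seq I) (P : pred I) (f : I -> V -> R) :
  (forall i, P i -> Ck k U (f i)) ->
  Ck k U (fun x => \prod_(i <- r | P i) f i x).
Proof.
move=> h; elim: r => [|i r IH].
  by apply: eq_Ck (Ck_cst k (1 : R)) => x _; rewrite big_nil.
have [Pi|Pi] := boolP (P i); last first.
  by apply: eq_Ck IH => x _; rewrite big_cons (negbTE Pi).
by apply: eq_Ck (CkM (h i Pi) IH) => x _; rewrite big_cons Pi.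
Qed.

Lemma Ck_mulmx k m n p (f : V -> 'M[R]_(m, n)) (g : V -> 'M[R]_(n, p)) :
  Ck k U f -> Ck k U g -> Ck k U (fun x => f x *m g x).
Proof.
move=> /Ck_mxP hf /Ck_mxP hg; apply/Ck_mxP => i j.
apply: (@eq_Ck _ _ (fun x => \sum_l f x i l * g x l j)) => [x _|].
  by rewrite mxE.
by apply: Ck_sum => l _; exact: CkM.
Qed.

Lemma Ck_trmx k m n (f : V -> 'M[R]_(m, n)) :
  Ck k U f -> Ck k U (fun x => (f x)^T).
Proof.
move=> /Ck_mxP hf; apply/Ck_mxP => i j.
by apply: eq_Ck (hf j i) => x _; rewrite mxE.
Qed.

Lemma Ck_det k n (f : V -> 'M[R]_n) : Ck k U f -> Ck k U (fun x => \det (f x)).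
Proof.
move=> /Ck_mxP hf; apply: Ck_sum => s _; apply: CkM; first exact: Ck_cst.
by apply: Ck_prod => i _.
Qed.

(** Cramer's rule: the entries of the inverse are polynomials in the entries
    divided by the determinant. *)
Lemma Ck_invmx k n (f : V -> 'M[R]_n) : (forall x, U x -> f x \in unitmx) ->
  Ck k U f -> Ck k U (fun x => invmx (f x)).
Proof.
move=> f1 hf; apply/Ck_mxP => i j.
apply: (@eq_Ck _ _ (fun x => (\det (f x))^-1 * cofactor (f x) j i)) => [x Ux|].
  by rewrite /invmx f1// !mxE.
apply: CkM.
  by apply: CkV (Ck_det hf) => x /f1; rewrite unitmxE unitfE.
apply: CkM; first exact: Ck_cst.
apply: Ck_det; apply/Ck_mxP => a b.
apply: eq_Ck ((Ck_mxP _ _).1 hf (lift j a) (lift i b)) => x Ux.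
by rewrite !mxE.
Qed.

Lemma Ck_comp_real k (D : set R) (f : R -> R) (g : V -> R) :
  (forall x, U x -> D (g x)) -> Ck k D f -> Ck k U g -> Ck k U (f \o g).
Proof.
move=> gD; elim: k f => [|k IH] f.
  by move=> cf cg x Ux; apply: continuous_comp; [exact: cg|exact/cf/gD].
move=> [df Df] hg; have [dg Dg] := hg; split=> [x Ux|v].
  by apply: differentiable_comp; [exact: dg|exact/df/gD].
apply: (@eq_Ck _ _ ('D_v g * ('D_1 f \o g))) => [x Ux|].
  have ? := dg x Ux; have ? := df _ (gD _ Ux).
  rewrite [RHS]deriveE; last exact: differentiable_comp.
  rewrite diff_comp//= -[LHS]/('D_v g x * 'D_1 f (g x)) !deriveE//.
  rewrite -[in RHS](mulr1 ('d g x v)); symmetry.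
  exact: (linearZZ ('d f (g x)) ('d g x v) 1).
apply: CkM; first exact: (Dg v).
by apply: IH; [exact: (Df 1)|exact: CkW hg].
Qed.

(** The directional derivative of f \o g at x is the derivative of f along a
    direction that depends on x. Expanding this direction in the basis of
    row vectors gives the sum over j of (D_v g) 0 j times (D_(e_j) f) \o g,
    to which induction applies. *)
Lemma Ck_comp k m n p (D : set 'rV[R]_m) (f : 'rV[R]_m -> 'M[R]_(n, p))
  (g : V -> 'rV[R]_m) :
  (forall x, U x -> D (g x)) -> Ck k D f -> Ck k U g -> Ck k U (f \o g).
Proof.
move=> gD; elim: k f => [|k IH] f.
  by move=> cf cg x Ux; apply: continuous_comp; [exact: cg|exact/cf/gD].
move=> [df Df] hg; have [dg Dg] := hg; split=> [x Ux|v].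
  by apply: differentiable_comp; [exact: dg|exact/df/gD].
have {}Dg := (Ck_mxP _ _).1 (Dg v).
pose h j := 'D_(delta_mx 0 j) f \o g.
have hh j : Ck k U (h j) by apply: IH; [exact: Df|exact: CkW].
apply: (@eq_Ck _ _ (fun x => \sum_j 'D_v g x 0 j *: h j x)) => [x Ux|].
  have ? := dg x Ux; have ? := df _ (gD _ Ux).
  rewrite [RHS]deriveE; last exact: differentiable_comp.
  rewrite diff_comp//= [in RHS](row_sum_delta ('d g x v)) linear_sum.
  apply: eq_bigr => j _; rewrite linearZ -deriveE//.
  by rewrite /h /= !deriveE.
apply: Ck_sum => j _; apply/Ck_mxP => a b.
apply: (@eq_Ck _ _ (fun x => 'D_v g x 0 j * h j x a b)) => [x _|].
  by rewrite mxE.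
by apply: CkM => //; exact: ((Ck_mxP _ _).1 (hh j)).
Qed.

End OnOpen.

Lemma smooth_lsubmx (V : normedModType R) m n (U : set V)
    (f : V -> 'rV[R]_(m + n)) : open U ->
  smooth_on U f -> smooth_on U (fun x => lsubmx (f x)).
Proof.
move=> oU sf k; apply/Ck_mxP => // i j.
by apply: (eq_Ck oU) ((Ck_mxP oU _ _).1 (sf k) i (lshift n j)) => x _; rewrite mxE.
Qed.

Lemma smooth_rsubmx (V : normedModType R) m n (U : set V)
    (f : V -> 'rV[R]_(m + n)) : open U ->
  smooth_on U f -> smooth_on U (fun x => rsubmx (f x)).
Proof.
move=> oU sf k; apply/Ck_mxP => // i j.
by apply: (eq_Ck oU) ((Ck_mxP oU _ _).1 (sf k) i (rshift m j)) => x _; rewrite mxE.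
Qed.

Lemma smooth_row_mx (V : normedModType R) m n (U : set V)
    (f : V -> 'rV[R]_m) (g : V -> 'rV[R]_n) :
  open U -> smooth_on U f -> smooth_on U g ->
  smooth_on U (fun x => row_mx (f x) (g x)).
Proof.
move=> oU sf sg k; apply/Ck_mxP => // i j; case: (split_ordP j) => l ->.
  by apply: (eq_Ck oU) ((Ck_mxP oU _ _).1 (sf k) i l) => x _; rewrite row_mxEl.
by apply: (eq_Ck oU) ((Ck_mxP oU _ _).1 (sg k) i l) => x _; rewrite row_mxEr.
Qed.

Lemma smooth_comp (V : normedModType R) m n p (U : set V) (D : set 'rV[R]_m)
    (f : 'rV[R]_m -> 'M[R]_(n, p)) (g : V -> 'rV[R]_m) : open U ->
  (forall x, U x -> D (g x)) -> smooth_on D f -> smooth_on U g ->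
  smooth_on U (f \o g).
Proof. by move=> oU gD sf sg k; exact: Ck_comp gD (sf k) (sg k). Qed.

End SmoothCalculus.

(** * Entire power series and the functions of rho squared *)

Section EntireSeries.
Context {R : realType}.
Implicit Types (c : nat -> R) (x : R).

(** The bound by A / n! is preserved by termwise derivation and by the
    shift, and it makes the series converge on the whole line. *)
Definition entire c := exists2 A, 0 <= A & forall n, `|c n| <= A * (n`!%:R)^-1.

Definition psum c x : R := limn (pseries c x).

Lemma entire_cvg c x : entire c -> cvgn (pseries c x).
Proof.
move=> [A A0 hc]; apply: normed_cvg.
have hA : cvgn (series (fun n => A * exp_coeff `|x| n)).
  rewrite (_ : series _ = (fun n => A * series (exp_coeff `|x|) n)).
    by apply: is_cvgMr; exact: is_cvg_series_exp_coeff.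
  by apply/funext => n; rewrite /series/= mulr_sumr.
apply: series_le_cvg hA => n //=.
- by rewrite mulr_ge0// divr_ge0// ?exprn_ge0// ler0n.
- have := ler_wpM2r (exprn_ge0 n (normr_ge0 x)) (hc n).
  by rewrite normrM normrX => /le_trans; apply; rewrite mulrAC mulrA.
Qed.

Lemma entire_diffs c : entire c -> entire (pseries_diffs c).
Proof.
move=> [A A0 hc]; exists A => // n; rewrite /pseries_diffs normrM normr_nat.
have := hc n.+1; rewrite factS natrM invfM.
rewrite mulrCA -(ler_pM2l (_ : 0 < n.+1%:R))// mulVKf//.
Qed.

Lemma entire_shift c : entire c -> entire (fun n => c n.+1).
Proof.
move=> [A A0 hc]; exists A => // n; apply: le_trans (hc _) _.
rewrite ler_wpM2l// lef_pV2 ?posrE ?ltr0n ?fact_gt0// ler_nat factS.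
by rewrite leq_pmull.
Qed.

(** Division by x of a power series without constant term is a shift of the
    coefficients; this is how removable singularities at 0 are handled. *)
Lemma psum_shift c x : entire c -> psum c x = c 0%N + x * psum (fun n => c n.+1) x.
Proof.
move=> ec; apply/cvg_lim => //; rewrite -(cvg_shiftS (pseries c x)).
rewrite (_ : (fun n => _) = (fun n => c 0%N + x * pseries (fun n => c n.+1) x n)).
  apply: cvgD; first exact: cvg_cst.
  by apply: cvgMr; exact/entire_cvg/entire_shift.
apply/funext => n; rewrite /pseries /series /= big_nat_recl//= expr0 mulr1.
by congr (_ + _); rewrite mulr_sumr; apply: eq_bigr => i _; rewrite exprS mulrCA.
Qed.

Lemma is_derive_psum c x : entire c ->
  is_derive x 1 (psum c) (psum (pseries_diffs c) x).
Proof.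
move=> ec; apply: (@pseries_snd_diffs _ c (`|x| + 1)).
- exact: entire_cvg.
- exact/entire_cvg/entire_diffs.
- exact/entire_cvg/entire_diffs/entire_diffs.
- by rewrite [ltRHS]ger0_norm ?ltrDl// addr_ge0.
Qed.

(** Induction on the class, for all members at once: each derivative is
    again in the family. *)
Lemma smooth_of_derivative_family (I : Type) (D : set R) (f : I -> R -> R)
    (f' : I -> I) : open D ->
  (forall i x, D x -> is_derive x 1 (f i) (f (f' i) x)) ->
  forall i, smooth_on D (f i).
Proof.
move=> oD df i k; elim: k i => [|k IH] i.
  move=> x Dx; apply/differentiable_continuous/derivable1_diffP.
  by have [] := df i x Dx.
have dif x : D x -> differentiable (f i) x.
  by move=> Dx; apply/derivable1_diffP; have [] := df i x Dx.
split=> // v; apply: (@eq_Ck _ _ _ oD _ _ (cst v * f (f' i))).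
  move=> x Dx; rewrite deriveE; last exact: dif.
  rewrite -[v in RHS]mulr1 [RHS](linearZZ _ v 1) -deriveE; last exact: dif.
  by have [_ ->] := df i x Dx.
by apply: CkM => //; exact: Ck_cst.
Qed.

Lemma smooth_psum c : entire c -> smooth_on setT (psum c).
Proof.
move=> ec; pose f (s : {c : nat -> R | entire c}) := psum (sval s).
pose f' (s : {c : nat -> R | entire c}) : {c : nat -> R | entire c} :=
  exist _ (pseries_diffs (sval s)) (entire_diffs (svalP s)).
apply: (@smooth_of_derivative_family _ setT f f' openT _ (exist _ c ec)) => s x _.
exact: is_derive_psum (svalP s).
Qed.

(** The functions sin, cos and their opposites are closed under derivation;
    the first boolean is the sign and the second one selects sin. *)
Lemma smooth_sin_cos : smooth_on setT (@sin R) /\ smooth_on setT (@cos R).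
Proof.
pose f (b : bool * bool) : R -> R :=
  cst ((-1) ^+ b.1) * (if b.2 then @sin R else @cos R).
have hf b : smooth_on setT (f b).
  apply: (@smooth_of_derivative_family _ setT f
    (fun b => (b.1 (+) ~~ b.2, ~~ b.2))) => [|[b1 b2] x _]; first exact: openT.
  rewrite /f; case: b2 => /=; apply: is_derive_eq; rewrite scaler0 addr0.
    by rewrite addbF.
  rewrite -[LHS]/((-1) ^+ b1 * - sin x) -[RHS]/((-1) ^+ (b1 (+) true) * sin x).
  by rewrite signr_addb expr1 mulrN1 mulrN mulNr.
have E g b : (if b then @sin R else @cos R) = g -> smooth_on setT g.
  move=> <- k; apply: eq_Ck (hf (false, b) k) => [|x _]; first exact: openT.
  by rewrite /f /= -[LHS]/(_ * _) expr0 mul1r.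
by split; [exact: (E _ true)|exact: (E _ false)].
Qed.

End EntireSeries.

Section CosSinSqrt.
Context {R : realType}.

Definition cos_sqrt_coeff n : R := (-1) ^+ n / (n.*2)`!%:R.
Definition sin_sqrt_coeff n : R := (-1) ^+ n / (n.*2.+1)`!%:R.

(** These are cos (sqrt u) and sin (sqrt u) / sqrt u, extended to all real u
    by their power series. *)
Definition cos_sqrt := psum cos_sqrt_coeff.
Definition sinc_sqrt := psum sin_sqrt_coeff.

Lemma entire_alternating (k : nat -> nat) : (forall n, n <= k n)%N ->
  entire (fun n => (-1) ^+ n / (k n)`!%:R : R).
Proof.
move=> h; exists 1 => // n; rewrite normrM normrX normrN1 expr1n !mul1r.
rewrite ger0_norm ?invr_ge0// lef_pV2 ?posrE ?ltr0n ?fact_gt0// ler_nat.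
exact: leq_fact.
Qed.

Lemma entire_cos_sqrt : entire cos_sqrt_coeff.
Proof. by apply: entire_alternating => n; rewrite -addnn leq_addr. Qed.

Lemma entire_sin_sqrt : entire sin_sqrt_coeff.
Proof. by apply: entire_alternating => n; rewrite -addnn -addSn leq_addl. Qed.

Lemma cos_sqrtE x : cos_sqrt (x ^+ 2) = cos x.
Proof.
apply/cvg_lim => //; rewrite (_ : pseries _ _ = series (cos_coeff' x)).
  exact: cvg_cos_coeff'.
apply/funext => n; apply: eq_bigr => i _.
by rewrite /= /cos_sqrt_coeff /cos_coeff' -exprM mul2n mulrAC.
Qed.

Lemma sinc_sqrtE x : x * sinc_sqrt (x ^+ 2) = sin x.
Proof.
apply: (@cvg_unique _ _ (series (sin_coeff' x) @ \oo)) => //.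
  rewrite (_ : series _ = (fun n => x * pseries sin_sqrt_coeff (x ^+ 2) n)).
    by apply: cvgMr; exact/entire_cvg/entire_sin_sqrt.
  apply/funext => n; rewrite /pseries /series /= mulr_sumr.
  apply: eq_bigr => i _.
  rewrite /sin_sqrt_coeff /sin_coeff' -exprM mul2n exprS.
  by rewrite [RHS]mulrCA [RHS]mulrAC.
exact: cvg_sin_coeff'.
Qed.

Lemma sinc_sqrt0 : sinc_sqrt 0 = 1.
Proof.
rewrite /sinc_sqrt psum_shift ?mul0r ?addr0; last exact: entire_sin_sqrt.
by rewrite /sin_sqrt_coeff expr0 divr1.
Qed.

Lemma smooth_cos_sqrt : smooth_on setT cos_sqrt.
Proof. exact: smooth_psum entire_cos_sqrt. Qed.

Lemma smooth_sinc_sqrt : smooth_on setT sinc_sqrt.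
Proof. exact: smooth_psum entire_sin_sqrt. Qed.

(** These are (cos_sqrt u - 1) / u and (sinc_sqrt u - 1) / u, with their
    limits at u equal to 0. *)
Definition cos_sqrt1 : R -> R := psum (fun n => cos_sqrt_coeff n.+1).
Definition sinc_sqrt1 : R -> R := psum (fun n => sin_sqrt_coeff n.+1).

Lemma cos_sqrt1E u : cos_sqrt u = 1 + u * cos_sqrt1 u.
Proof.
rewrite /cos_sqrt psum_shift; last exact: entire_cos_sqrt.
by rewrite /cos_sqrt_coeff expr0 divr1.
Qed.

Lemma sinc_sqrt1E u : sinc_sqrt u = 1 + u * sinc_sqrt1 u.
Proof.
rewrite /sinc_sqrt psum_shift; last exact: entire_sin_sqrt.
by rewrite /sin_sqrt_coeff expr0 divr1.
Qed.

Lemma smooth_cos_sqrt1 : smooth_on setT cos_sqrt1.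
Proof. exact/smooth_psum/entire_shift/entire_cos_sqrt. Qed.

Lemma smooth_sinc_sqrt1 : smooth_on setT sinc_sqrt1.
Proof. exact/smooth_psum/entire_shift/entire_sin_sqrt. Qed.

End CosSinSqrt.

(** * Smoothness of explicit formulas *)

Section SmoothCombinators.
Context {R : realType} {V : normedModType R} (U : set V).

Lemma smooth_cst (W : normedModType R) (a : W) : smooth_on U (fun=> a).
Proof. by move=> k; exact: Ck_cst. Qed.

Lemma smooth_id : smooth_on U (fun x => x).
Proof. by move=> k; exact: Ck_id. Qed.

Hypothesis oU : open U.

Lemma smoothD (W : normedModType R) (f g : V -> W) :
  smooth_on U f -> smooth_on U g -> smooth_on U (fun x => f x + g x).
Proof. by move=> sf sg k; exact: (CkD oU (sf k) (sg k)). Qed.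

Lemma smoothN (W : normedModType R) (f : V -> W) :
  smooth_on U f -> smooth_on U (fun x => - f x).
Proof. by move=> sf k; exact: (CkN oU (sf k)). Qed.

Lemma smoothM (f g : V -> R) :
  smooth_on U f -> smooth_on U g -> smooth_on U (fun x => f x * g x).
Proof. by move=> sf sg k; exact: (CkM oU (sf k) (sg k)). Qed.

Lemma smoothX (f : V -> R) n :
  smooth_on U f -> smooth_on U (fun x => f x ^+ n).
Proof.
move=> sf; elim: n => [|n IH]; first exact: smooth_cst.
by apply: (eq_smooth oU _ (smoothM sf IH)) => x _; rewrite exprS.
Qed.

Lemma smoothV (f : V -> R) : (forall x, U x -> f x != 0) ->
  smooth_on U f -> smooth_on U (fun x => (f x)^-1).
Proof. by move=> f0 sf k; exact: (CkV oU f0 (sf k)). Qed.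

Lemma smooth_entry m n (f : V -> 'M[R]_(m, n)) i j :
  smooth_on U f -> smooth_on U (fun x => f x i j).
Proof. by move=> sf k; exact: ((Ck_mxP oU _ _).1 (sf k)). Qed.

Lemma smooth_mx m n (f : V -> 'M[R]_(m, n)) :
  (forall i j, smooth_on U (fun x => f x i j)) -> smooth_on U f.
Proof. by move=> sf k; apply/Ck_mxP => // i j; exact: sf. Qed.

Lemma smooth_comp_real (D : set R) (f : R -> R) (g : V -> R) :
  (forall x, U x -> D (g x)) -> smooth_on D f -> smooth_on U g ->
  smooth_on U (fun x => f (g x)).
Proof. by move=> gD sf sg k; exact: (Ck_comp_real oU gD (sf k) (sg k)). Qed.

Lemma smooth_cos (g : V -> R) : smooth_on U g -> smooth_on U (fun x => cos (g x)).
Proof. exact/smooth_comp_real/smooth_sin_cos.2. Qed.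

Lemma smooth_sin (g : V -> R) : smooth_on U g -> smooth_on U (fun x => sin (g x)).
Proof. exact/smooth_comp_real/smooth_sin_cos.1. Qed.

Lemma smooth_row2 (f g : V -> R) : smooth_on U f -> smooth_on U g ->
  smooth_on U (fun x => row2 (f x) (g x)).
Proof.
move=> sf sg; apply: smooth_mx => i j; rewrite /row2.
case: j => -[|[|//]] h.
  by apply: (eq_smooth oU _ sf) => x _; rewrite mxE.
by apply: (eq_smooth oU _ sg) => x _; rewrite mxE.
Qed.

End SmoothCombinators.

Ltac smooth_tac := repeat first
  [ assumption | apply: smooth_cst | apply: smooth_id | apply: smoothD
  | apply: smoothN | apply: smoothM | apply: smoothX | apply: smooth_cos
  | apply: smooth_sin | apply: smooth_entry | apply: smooth_row2
  | apply: smooth_lsubmx | apply: smooth_rsubmx | apply: smooth_row_mx ].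

Section SmoothSqrt.
Context {R : realType}.

(** Induction on the class: the derivative is the inverse of 2 sqrt. *)
Lemma smooth_sqrt : smooth_on [set x : R | 0 < x] (@Num.sqrt R).
Proof.
have oD : open [set x : R | 0 < x] by exact: open_gt.
have ds (x : R) : 0 < x -> differentiable (@Num.sqrt R) x.
  by move=> x0; apply/derivable1_diffP; have [] := is_derive1_sqrt x0.
elim=> [|k IH]; first by move=> x x0; apply/differentiable_continuous/ds.
split=> [x x0|v]; first exact: ds.
have E x : 0 < x -> v * (2 * Num.sqrt x)^-1 = 'D_v (@Num.sqrt R) x.
  move=> x0; rewrite deriveE; last exact: ds.
  rewrite -[v in RHS]mulr1 [RHS](linearZZ _ v 1) -deriveE; last exact: ds.
  by have [_ ->] := is_derive1_sqrt x0.
apply: (eq_Ck oD (f := fun x : R => v * (2 * Num.sqrt x)^-1)) => [x /E//|].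
apply: (CkM oD (Ck_cst _ k (v : R))); apply: (CkV oD) => [x x0|].
  by rewrite mulf_neq0// gt_eqF// sqrtr_gt0.
exact: (CkM oD (Ck_cst _ k (2 : R)) IH).
Qed.

End SmoothSqrt.

(** * The inverse function theorem for injective maps *)

Section Jacobian.
Context {R : realType}.

Lemma jacobianE m n (f : 'rV[R]_m -> 'rV[R]_n) x i j : differentiable f x ->
  'J f x i j = 'D_(delta_mx 0 i) f x 0 j.
Proof. by move=> df; rewrite deriveE// /jacobian mxE. Qed.

Lemma diff_jacobian m n (f : 'rV[R]_m -> 'rV[R]_n) x v :
  'd f x v = v *m 'J f x.
Proof. by rewrite mul_rV_lin1. Qed.

Lemma smooth_jacobian m n (U : set 'rV[R]_m) (f : 'rV[R]_m -> 'rV[R]_n) :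
  open U -> smooth_on U f -> smooth_on U (jacobian f).
Proof.
move=> oU sf k; apply/Ck_mxP => // i j.
apply: (eq_Ck oU) ((Ck_mxP oU _ _).1 (smooth_derive (delta_mx 0 i) sf k) 0 j).
by move=> x Ux; rewrite jacobianE//; exact: smooth_differentiable sf Ux.
Qed.

Lemma surjective_unitmx n (A : 'M[R]_n) :
  (forall w : 'rV_n, exists v, v *m A = w) -> A \in unitmx.
Proof.
move=> h; rewrite -row_full_unit -sub1mx; apply/row_subP => i.
by have [v <-] := h (row i 1%:M); exact: submxMl.
Qed.

Lemma injective_unitmx n (A : 'M[R]_n) :
  (forall v : 'rV_n, v *m A = 0 -> v = 0) -> A \in unitmx.
Proof.
move=> h; rewrite -row_free_unit -kermx_eq0; apply/eqP/row_matrixP => i.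
by rewrite row0; apply: h; rewrite -row_mul mulmx_ker row0.
Qed.

Lemma mulmxr_continuous m n p (A : 'M[R]_(n, p)) :
  continuous (mulmxr A : 'M[R]_(m, n) -> 'M[R]_(m, p)).
Proof.
move=> x; have : Ck 0 setT (fun y : 'M[R]_(m, n) => y *m A).
  by apply: Ck_mulmx; [exact: openT|exact: Ck_id|exact: Ck_cst].
exact.
Qed.

End Jacobian.

Section InverseFunction.
Context {R : realType}.

(** The squared Euclidean length; the norm of row vectors is the sup norm. *)
Let N n (y : 'rV[R]_n) : R := \sum_i y 0 i ^+ 2.

Let N_ge0 n (y : 'rV[R]_n) : 0 <= N y.
Proof. by apply: sumr_ge0 => i _; exact: sqr_ge0. Qed.

Let N_eq0 n (y : 'rV[R]_n) : N y = 0 -> y = 0.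
Proof.
move=> /eqP; rewrite psumr_eq0 => [/allP h|i _]; last exact: sqr_ge0.
apply/rowP => i; rewrite mxE; apply/eqP.
by have /implyP/(_ isT) := h i (mem_index_enum i); rewrite sqrf_eq0.
Qed.

Let N_lower n (y z : 'rV[R]_n) : N y / 2 - N z <= N (y - z).
Proof.
rewrite /N mulr_suml -sumrB; apply: ler_sum => i _; rewrite !mxE.
by have := sqr_ge0 (y 0 i - 2 * z 0 i); lra.
Qed.

Let N_continuous n : continuous (@N n).
Proof.
move=> x; suff /(_ x I) : Ck 0 setT (@N n) by [].
apply: Ck_sum => [|i _]; first exact: openT.
have h : Ck 0 setT (fun y : 'rV[R]_n => y 0 i).
  exact: ((Ck_mxP openT 0 (id : 'rV[R]_n -> 'rV[R]_n)).1 (Ck_id _ 0) 0 i).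
exact: (CkM openT h h).
Qed.

(** Fermat's rule, from the first-order approximation along c + t u with t
    small and positive. *)
Lemma differential_min0 (V : normedModType R) (f : V -> R) (c v : V) :
  differentiable f c -> (\forall y \near c, f c <= f y) -> 'd f c v = 0.
Proof.
move=> df fmin.
suff h u : 0 <= 'd f c u.
  by apply/eqP; rewrite eq_le h andbT -oppr_ge0 -raddfN h.
have [->|u0] := eqVneq u 0; first by rewrite linear0.
rewrite leNgt; apply/negP => fu0.
pose e := - 'd f c u / (2 * `|u|).
have u1 : 0 < `|u| by rewrite normr_gt0.
have e0 : 0 < e by rewrite divr_gt0// ?mulr_gt0// oppr_gt0.
have : \forall y \near c, f c <= f y /\
    `|f y - f c - 'd f c (y - c)| <= e * `|y - c|.
  by apply: filterI => //; exact: diff_approx.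
move=> /nbhs_ballP[d /= d0 hd].
pose t := d / (2 * `|u|).
have t0 : 0 < t by rewrite divr_gt0// mulr_gt0.
have : ball c d (c + t *: u).
  rewrite -ball_normE /= opprD addrA subrr add0r normrN normrZ gtr0_norm//.
  by rewrite /t invfM mulrA divfK ?gt_eqF// ltr_pdivrMr//; lra.
move=> /hd[h1]; rewrite [c + t *: u - c]addrAC subrr add0r linearZ /=.
rewrite normrZ (gtr0_norm t0).
rewrite (_ : e * _ = t * (- 'd f c u / 2)); last first.
  rewrite /e; field; exact: lt0r_neq0.
rewrite ler_norml => /andP[_].
move: h1; set a := f _; set b := f c; set q := 'd f c u => ab.
have : t * q < 0 by rewrite pmulr_rlt0.
rewrite -[t *: q]/(t * q); lra.
Qed.

Section Openness.
Context {n : nat} (U : set 'rV[R]_n) (G : 'rV[R]_n -> 'rV[R]_n).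
Hypotheses (oU : open U) (sG : smooth_on U G) (injG : set_inj U G).
Hypothesis surjG : forall x, U x -> forall w, exists v, 'd G x v = w.

Let dG x : U x -> differentiable G x.
Proof. exact: smooth_differentiable. Qed.

(** For y close to G b, minimise the squared Euclidean distance from G x to
    y over a closed ball around b. By injectivity, G stays away from G b on
    the boundary sphere, so the minimum is attained inside the ball. There
    the gradient vanishes, and as the differential is onto, the distance
    itself is zero. *)
Lemma image_nbhs_of_surjective_differential b : U b -> nbhs (G b) (G @` U).
Proof.
move=> Ub; have /nbhs_ballP[e /= e0 beU] := open_nbhs_nbhs (conj oU Ub).
pose r := e / 2; have r0 : 0 < r by rewrite divr_gt0.
pose K := [set x : 'rV[R]_n | `|x - b| <= r].
pose S := [set x : 'rV[R]_n | `|x - b| = r].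
have KU x : K x -> U x.
  move=> Kx; apply: beU; rewrite -ball_normE /= distrC.
  by apply: le_lt_trans Kx _; rewrite /r; lra.
have ncont : continuous (fun x : 'rV[R]_n => `|x - b|).
  move=> x.
  have h : {for x, continuous (fun x : 'rV[R]_n => x - b)}.
    by apply: continuousB; [apply: cvg_id|apply: cst_continuous].
  exact: (continuous_comp h (@norm_continuous _ _ _)).
have compact_bcl (A : set 'rV[R]_n) : A `<=` K -> closed A -> compact A.
  move=> AK; apply: bounded_closed_compact; exists (r + `|b|).
  split=> [|M rM x /AK Kx]; first exact: num_real.
  apply: ltW; apply: le_lt_trans rM.
  by rewrite -[x](subrK b) (le_trans (ler_normD _ _))// lerD2r.
have cK : compact K.
  apply: compact_bcl => //; apply: preimage_closed (@closed_le _ r).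
  by move=> x _; exact: ncont.
have cS : compact S.
  apply: compact_bcl => [x Sx|]; first by rewrite /K/= Sx.
  apply: preimage_closed (@closed_eq _ r).
  by move=> x _; exact: ncont.
have contN (A : set 'rV[R]_n) y : A `<=` U ->
    {within A, continuous (fun x => N (G x - y))}.
  move=> AU; apply: continuous_in_subspaceT => x /set_mem Ax.
  have h : {for x, continuous (fun x => G x - y)}.
    apply: continuousB; last exact: cst_continuous.
    exact/differentiable_continuous/dG/AU.
  exact: (continuous_comp h (@N_continuous _ _)).
(* The gap m is arbitrary when the sphere is empty, as in dimension 0. *)
have [m m0 hm] : exists2 m, 0 < m & forall x, S x -> m <= N (G x - G b).
  have SU : S `<=` U by move=> x /= Sx; apply: KU; rewrite /K/= Sx.
  have [S0|S0] := pselect (S !=set0); last first.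
    by exists 1 => // x Sx; case: S0; exists x.
  have [c /set_mem Sc hc] := compact_EVT_min S0 cS (contN _ (G b) SU).
  exists (N (G c - G b)) => [|x Sx]; last exact/hc/mem_set.
  rewrite lt0r N_ge0 andbT; apply/eqP => /N_eq0/eqP; rewrite subr_eq0 => /eqP.
  move=> /(injG (mem_set (SU _ Sc)) (mem_set Ub)) cb.
  by move: Sc r0; rewrite /S/= cb subrr normr0 => <-; rewrite ltxx.
(* With N y / 2 - N z <= N (y - z), the bound m / 4 makes the value at b smaller
   than all values on the sphere. *)
have : \forall y \near G b, N (G b - y) < m / 4.
  have : {for G b, continuous (fun y : 'rV[R]_n => N (G b - y))}.
    have h : {for G b, continuous (fun y : 'rV[R]_n => G b - y)}.
      by apply: continuousB; [apply: cst_continuous|apply: cvg_id].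
    exact: (continuous_comp h (@N_continuous _ _)).
  move=> /cvgr_lt; apply.
  rewrite subrr /N big1 ?divr_gt0// => i _.
  by rewrite mxE expr0n.
apply: filterS => y Gby.
have K0 : K !=set0 by exists b; rewrite /K/= subrr normr0 ltW.
have [c /set_mem Kc hc] := compact_EVT_min K0 cK (contN _ y KU).
have Uc := KU _ Kc; exists c => //.
have cb : `|c - b| < r.
  rewrite lt_neqAle; apply/andP; split=> //; apply/eqP => Sc.
  have := hm _ Sc; have := hc b (mem_set _).
  rewrite /K/= subrr normr0 => /(_ (ltW r0)).
  have := N_lower (G c - G b) (y - G b); rewrite opprB addrA subrK.
  rewrite (_ : N (y - G b) = N (G b - y)); first by lra.
  by apply: eq_bigr => i _; rewrite !mxE -sqrrN opprB.
have dphi : differentiable (fun x => N (G x - y)) c /\ forall v,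
    'd (fun x => N (G x - y)) c v = 2 * \sum_i (G c - y) 0 i * 'd G c v 0 i.
  have h i : differentiable (fun x => (G x - y) 0 i) c.
    apply: (differentiable_mxP (fun x => G x - y) c).1.
    by apply: differentiableB; [exact: dG|exact: differentiable_cst].
  have E : (fun x => N (G x - y)) = \sum_i (fun x => (G x - y) 0 i) ^+ 2.
    by apply/funext => x; rewrite fct_sumE.
  have dphi : differentiable (fun x => N (G x - y)) c.
    by rewrite E; apply: differentiable_sum => i; exact/differentiableX/h.
  split=> // v; rewrite -deriveE// E derive_sum => [|i].
    rewrite mulr_sumr; apply: eq_bigr => i _.
    rewrite deriveX; last exact/diff_derivable/h.
    rewrite -(derive_mxE v 0 i); last by apply: differentiableB => //; exact: dG.
    rewrite deriveB; [|exact/diff_derivable/dG|exact: derivable_cst].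
    rewrite derive_cst subr0 deriveE; last exact: dG.
    by rewrite expr1 mulrA mulr_natl.
  exact/derivableX/diff_derivable/h.
have [v dv] := surjG Uc (G c - y).
have cmin : \forall x \near c, N (G c - y) <= N (G x - y).
  have oK : open [set x : 'rV[R]_n | `|x - b| < r].
    apply: open_comp (@open_lt _ r).
    by move=> x _; exact: ncont.
  apply: (near_open oK cb) => x /= xb.
  by apply: hc; apply/mem_set/ltW.
have := differential_min0 v dphi.1 cmin; rewrite dphi.2 dv => /eqP.
rewrite mulf_eq0 pnatr_eq0 /= => /eqP h0.
have /N_eq0/eqP : N (G c - y) = 0 by exact: h0.
by rewrite subr_eq0 => /eqP.
Qed.

End Openness.

(** The image of every open subset is open by the previous lemma, so the
    inverse F is continuous. At y = G b the estimate |F y' - b| <= 2 M |y' -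
    y|, where M bounds the inverse of the differential, turns the first-
    order expansion of G into one of F. Hence F has Jacobian matrix invmx
    ('J G (F y)), and smoothness follows by induction, because this formula
    involves F only. *)
Theorem smooth_inverse n (U : set 'rV[R]_n) (G : 'rV[R]_n -> 'rV[R]_n) :
  open U -> smooth_on U G -> set_inj U G ->
  (forall x, U x -> forall w, exists v, 'd G x v = w) ->
  exists F, [/\ open (G @` U), smooth_on (G @` U) F &
                forall x, U x -> F (G x) = x].
Proof.
move=> oU sG injG surjG.
have oG (U' : set 'rV[R]_n) : open U' -> U' `<=` U -> open (G @` U').
  move=> oU' U'U; rewrite openE => _ [b U'b <-].
  apply: image_nbhs_of_surjective_differential => //.
  - exact: smooth_subset sG.
  - by move=> x y /set_mem/U'U xU /set_mem/U'U yU; exact: injG (mem_set _) (mem_set _).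
  - by move=> x /U'U; exact: surjG.
have oGU := oG U oU (@subset_refl _ U).
pose F y := get [set x | U x /\ G x = y].
have FG x : U x -> F (G x) = x.
  move=> Ux; have [UF GF] := @getPex _ [set z | U z /\ G z = G x]
    (ex_intro _ x (conj Ux erefl)).
  exact: injG (mem_set UF) (mem_set Ux) GF.
have J1 x : U x -> 'J G x \in unitmx.
  move=> Ux; apply: surjective_unitmx => w.
  by have [v <-] := surjG x Ux w; exists v; rewrite diff_jacobian.
have Fball b e : U b -> 0 < e -> \forall y \near G b, exists x,
    [/\ U x, ball b e x & y = G x].
  move=> Ub e0.
  have : nbhs (G b) (G @` (U `&` ball b e)).
    apply: open_nbhs_nbhs; split.
      by apply: oG; [apply: openI => //; exact: ball_open|move=> x []].
    by exists b => //; split=> //; exact: ballxx.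
  by apply: filterS => _ [x [Ux bx] <-]; exists x.
have dF b : U b -> is_diff (G b) F (mulmxr (invmx ('J G b))).
  move=> Ub; pose L : {linear 'rV[R]_n -> 'rV[R]_n} := mulmxr (invmx ('J G b)).
  have cL : continuous L by exact: mulmxr_continuous.
  apply: (@is_diff_approx _ _ _ _ _ L) => // e e0.
  have [M M0 LM] := linear_lipschitz cL.
  (* The first bound gives M e' <= 1 / 2, which absorbs |x - b|; the second one
     turns M e' (2 M |y' - y|) into e |y' - y|. *)
  pose e' := Num.min (1 / (2 * M)) (e / (2 * M * M)).
  have e'0 : 0 < e' by rewrite lt_min !divr_gt0// !mulr_gt0.
  have e'1 : M * e' <= 1 / 2.
    have : e' <= 1 / (2 * M) by rewrite ge_min lexx.
    by rewrite !ler_pdivlMr ?mulr_gt0//; lra.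
  have e'2 : 2 * M * (M * e') <= e.
    have : e' <= e / (2 * M * M) by rewrite ge_min lexx orbT.
    by rewrite ler_pdivlMr ?mulr_gt0//; lra.
  have dG : differentiable G b by exact: smooth_differentiable sG Ub.
  have /nbhs_ballP[d /= d0 hd] := diff_approx dG e'0.
  have := Fball b d Ub d0; apply: filterS => _ [x [Ux /hd hx ->]].
  rewrite !FG//.
  have E : L (G x - G b - 'd G b (x - b)) = - (x - b - L (G x - G b)).
    by rewrite linearB /= diff_jacobian mulmxK ?opprB//; exact: J1.
  have h1 : `|x - b - L (G x - G b)| <= M * e' * `|x - b|.
    by rewrite -normrN -E (le_trans (LM _))// -mulrA ler_wpM2l// ltW.
  have h2 : `|x - b| <= 2 * M * `|G x - G b|.
    have : `|x - b| <= `|x - b - L (G x - G b)| + `|L (G x - G b)|.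
      by rewrite -[X in `|X| <= _](subrK (L (G x - G b))) ler_normD.
    have := LM (G x - G b); have := ler_wpM2r (normr_ge0 (x - b)) e'1.
    by lra.
  rewrite (le_trans h1)//.
  apply: (@le_trans _ _ (M * e' * (2 * M * `|G x - G b|))).
    by rewrite ler_wpM2l// ltW// mulr_gt0.
  by rewrite mulrA ler_wpM2r// (le_trans _ e'2)// mulrC.
exists F; split=> // k; elim: k => [|k IH].
  by move=> _ [b Ub <-]; apply: differentiable_continuous; case: (dF b Ub).
split=> [_ [b Ub <-]|v]; first by case: (dF b Ub).
have sJ := smooth_jacobian oU sG.
apply: (@eq_Ck _ _ _ oGU _ _ (fun y => v *m invmx ('J G (F y)))).
  move=> _ [b Ub <-]; have [? E] := dF b Ub.
  by rewrite deriveE// E FG.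
apply: Ck_mulmx => //; first exact: Ck_cst.
have UF y : (G @` U) y -> U (F y) by move=> [b Ub <-]; rewrite FG.
apply: Ck_invmx => // [y /UF/J1//|].
exact: (Ck_comp oGU UF (sJ k) IH).
Qed.

End InverseFunction.

(** * Local representatives, diffeomorphisms and transported metrics *)

Section LocalRepresentatives.
Context {R : realType}.

Lemma open_preimageI {T U : topologicalType} (f : T -> U) (A : set T)
    (B : set U) : open A -> open B ->
  (forall x, A x -> {for x, continuous f}) -> open (A `&` f @^-1` B).
Proof.
move=> oA oB cf; rewrite openE => x [Ax Bfx].
apply: filterI; first exact: open_nbhs_nbhs.
by apply: (cf x Ax); exact: open_nbhs_nbhs.
Qed.

Lemma eq_inner n T (M : manifold R n T) (g : metric M) (i : idx M)
    (a a' v v' w w' : 'rV[R]_n) :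
  a = a' -> v = v' -> w = w' -> inner g i a v w = inner g i a' v' w'.
Proof. by move=> -> -> ->. Qed.

Section OneMap.
Context {m n : nat} {T T' : Type} {M : manifold R m T} {N : manifold R n T'}.
Implicit Types (f : T -> T') (i : idx M) (j : idx N).

Lemma local_rep_at f i a j F : local_rep f i a j F ->
  [/\ dom i a, dom j (F a) & par j (F a) = f (par i a)].
Proof. by move=> [U [_ Ua Ui _ h]]; have [? ?] := h a Ua; split=> //; exact: Ui. Qed.

Lemma local_rep_differentiable f i a j F :
  local_rep f i a j F -> differentiable F a.
Proof. by move=> [U [_ Ua _ sF _]]; exact: smooth_differentiable sF Ua. Qed.

Lemma eq_local_rep f f' i a j F :
  (forall x, dom i x -> f (par i x) = f' (par i x)) ->
  local_rep f i a j F -> local_rep f' i a j F.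
Proof.
move=> ff' [U [oU Ua Ui sF h]]; exists U; split=> // x Ux.
by have [? ->] := h x Ux; split=> //; exact/ff'/Ui.
Qed.

(** The parametrizations of the target are injective, so a representative is
    determined near a by the charts. Differential conditions on all
    representatives thus need to be checked on one only. *)
Lemma local_rep_unique f i a j F F' : set_inj (dom j) (par j) ->
  local_rep f i a j F -> local_rep f i a j F' -> \forall x \near a, F x = F' x.
Proof.
move=> inj [U [oU Ua Ui sF h]] [U' [oU' U'a Ui' sF' h']].
apply: (near_open (openI oU oU') (conj Ua U'a)) => x [Ux U'x].
have [d1 e1] := h x Ux; have [d2 e2] := h' x U'x.
by apply: (inj _ _ (mem_set d1) (mem_set d2)); rewrite e1 e2.
Qed.

Lemma near_diff f i a j F F' : local_rep f i a j F ->
  (\forall x \near a, F x = F' x) ->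
  F' a = F a /\ forall v, 'd F' a v = 'd F a v.
Proof.
move=> /local_rep_differentiable dF FF'; split.
  by rewrite (nbhs_singleton FF').
have [_ E] := near_eq_is_diff FF' dF => v.
exact: (congr1 (fun h : 'rV[R]_m -> 'rV[R]_n => h v) E).
Qed.

(** By uniqueness, the metric condition may be checked on one explicit
    representative at each point. *)
Lemma preservesI (g : metric M) (h : metric N) f : is_manifold N ->
  (forall i a j F, local_rep f i a j F -> exists F', local_rep f i a j F' /\
     forall v w, inner g i a v w = inner h j (F' a) ('d F' a v) ('d F' a w)) ->
  preserves g h f.
Proof.
move=> [charts _ _ _ _] H i a j F lF v w; have [F' [lF' ->]] := H _ _ _ _ lF.
have [E dE] := near_diff lF (local_rep_unique (charts j).2 lF lF').
exact: eq_inner.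
Qed.

Lemma par_pts i a : is_manifold M -> dom i a -> pts M (par i a).
Proof. by move=> [_ -> _ _ _] ia; exists i => //; exists a. Qed.

Lemma chart_at p : is_manifold M -> pts M p ->
  exists i a, dom i a /\ par i a = p.
Proof. by move=> [_ -> _ _ _] [i _ [a ia <-]]; exists i, a. Qed.

End OneMap.

Section TwoMaps.
Context {l m n : nat} {T T' T'' : Type}.
Context {M : manifold R l T} {N : manifold R m T'} {P : manifold R n T''}.

Lemma local_rep_comp (f : T -> T') (f' : T' -> T'')
    (i : idx M) a (j : idx N) (k : idx P) F F' :
  local_rep f i a j F -> local_rep f' j (F a) k F' ->
  local_rep (f' \o f) i a k (F' \o F) /\
  forall v, 'd (F' \o F) a v = 'd F' (F a) ('d F a v).
Proof.
move=> lF lF'; split=> [|v]; last first.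
  apply: diff_compE;
    [exact: local_rep_differentiable lF|exact: local_rep_differentiable lF'].
case: lF lF' => U [oU Ua Ui sF h] [U' [oU' U'a Uj sF' h']].
have oV : open (U `&` F @^-1` U').
  apply: (open_preimageI oU oU') => x Ux.
  exact/differentiable_continuous/(smooth_differentiable sF Ux).
exists (U `&` F @^-1` U'); split=> //.
- by move=> x [/Ui].
- move=> k0; apply: (@Ck_comp _ _ _ oV _ _ _ _ U') => //; first by move=> x [].
  by apply: Ck_subset (sF k0) => x [].
- move=> x [Ux U'x]; have [? E] := h x Ux; have [? E'] := h' _ U'x.
  by rewrite /= E' E.
Qed.

Lemma smooth_map_comp (f : T -> T') (f' : T' -> T'') :
  is_manifold M -> is_manifold N ->
  smooth_map M N f -> smooth_map N P f' -> smooth_map M P (f' \o f).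
Proof.
move=> Mm Nm [fN sf] [fP sf']; split=> [p /fN/fP//|i a k c ia kc E].
have [j [b [jb Eb]]] := chart_at Nm (fN _ (par_pts Mm ia)).
have [F lF] := sf i a j b ia jb Eb.
have [_ jF EF] := local_rep_at lF.
have [|F' lF'] := sf' j (F a) k c jF kc; first by rewrite E EF.
by exists (F' \o F); exact: (local_rep_comp lF lF').1.
Qed.

End TwoMaps.

(** The smooth inverse of a local representative represents the inverse map,
    so the inverse function theorem gives smoothness of the inverse map. *)
Lemma bijective_smooth_diffeo n (T T' : Type)
    (M : manifold R n T) (N : manifold R n T') f f' :
  is_manifold M -> is_manifold N -> smooth_map M N f ->
  (forall p, pts M p -> f' (f p) = p) ->
  (forall q, pts N q -> pts M (f' q) /\ f (f' q) = q) ->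
  (forall (i : idx M) a (j : idx N) F, local_rep f i a j F ->
     forall w, exists v, 'd F a v = w) ->
  diffeo M N f.
Proof.
move=> Mm Nm sf fK f'K dsurj; split=> //; exists f'.
split=> // [|q /f'K[]//]; split=> [q /f'K[]//|j b i a jb ia E].
have [Mch _ _ _ _] := Mm; have [Nch _ _ _ _] := Nm.
have Ea : f (par i a) = par j b by rewrite E; exact: (f'K _ (par_pts Nm jb)).2.
have [G lG] := sf.2 i a j b ia jb (esym Ea).
have Gab : G a = b.
  have [_ jG EG] := local_rep_at lG.
  by apply: ((Nch j).2 _ _ (mem_set jG) (mem_set jb)); rewrite EG Ea.
case: lG => U [oU Ua Ui sG h].
have injG : set_inj U G.
  move=> x y /set_mem Ux /set_mem Uy Gxy.
  apply: ((Mch i).2 _ _ (mem_set (Ui _ Ux)) (mem_set (Ui _ Uy))).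
  rewrite -(fK _ (par_pts Mm (Ui _ Ux))) -(fK _ (par_pts Mm (Ui _ Uy))).
  by rewrite -(h x Ux).2 -(h y Uy).2 Gxy.
have [|F [oGU sF FG]] := smooth_inverse oU sG injG.
  by move=> x Ux; apply: (dsurj i x j G); exists U.
exists F, (G @` U); split=> //.
- by exists a.
- by move=> _ [x Ux <-]; exact: (h x Ux).1.
- move=> _ [x Ux <-]; rewrite FG//; split; first exact: Ui.
  by rewrite (h x Ux).2 fK//; exact/par_pts/Ui.
Qed.

(** The Hausdorff condition is transported from R^n through the injective
    parametrization. *)
Lemma single_chart_manifold n (T : Type) (P : set T) (D : set 'rV[R]_n)
    (h : 'rV[R]_n -> T) : open D -> set_inj D h -> P = h @` D ->
  is_manifold (@Manifold R n T P unit (fun=> D) (fun=> h)).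
Proof.
move=> oD injh PE; split=> //=.
- by rewrite PE; apply/seteqP; split=> [p Pp|p [_ _ ?] //]; exists tt.
- rewrite PE; split=> // -[] a [] b Da Db hba; exists id, D.
  by split=> // k; exact: Ck_id.
- rewrite PE => _ _ [x Dx <-] [y Dy <-] hxy.
  have xy : x != y by apply/eqP => xy; apply: hxy; rewrite xy.
  have := @norm_hausdorff _ 'rV[R]_n; rewrite open_hausdorff => /(_ x y xy).
  move=> [[A B]] /= [/set_mem Ax /set_mem By] [oA oB AB].
  have open_img A' : open A' ->
      manifold_open (@Manifold R n T P unit (fun=> D) (fun=> h)) (h @` (A' `&` D)).
    move=> oA' [] /=; rewrite (_ : _ `&` _ = D `&` A'); first exact: openI.
    apply/seteqP; split=> [z [Dz [z' [Az' Dz'] E]]|z [Dz Az]].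
      by rewrite -(injh _ _ (mem_set Dz') (mem_set Dz) E).
    by split=> //; exists z.
  exists (h @` (A `&` D)), (h @` (B `&` D)); split.
  + exact: open_img.
  + exact: open_img.
  + by exists x.
  + by exists y.
  + apply/seteqP; split=> // z [[[x' [Ax' Dx'] <-] [y' [By' Dy'] E]] _].
    have E' := injh _ _ (mem_set Dy') (mem_set Dx') E.
    have : (A `&` B) x' by split=> //; rewrite -E'.
    by move/eqP : AB => ->.
- exists setT; split; first exact: countableP.
  by rewrite PE => _ [x Dx <-]; exists tt => //; exists x.
Qed.

End LocalRepresentatives.

Section PushForward.
Context {R : realType}.

(** The source has a single chart, so f^-1 has, in the chart j of the
    target, a representative F j defined on the whole domain. The metric is
    the pullback of h by F j; it is independent of charts because F j is F k
    composed with the transition. *)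
Lemma pushforward_metric n T T' (M : manifold R n T) (h : metric M)
    (Q : manifold R n T') f (i0 : idx M) :
  (forall i, i = i0) -> is_manifold Q -> riemannian h -> diffeo M Q f ->
  exists q : metric Q, riemannian q /\ preserves h q f.
Proof.
move=> i0E Qm [Mm smh symh posh _] [[fQ sf] [f' [[f'M sf'] ff' f'f]]].
have [Mch _ _ _ _] := Mm; have [Qch _ _ _ _] := Qm.
have cover p : pts M p -> exists x, dom i0 x /\ par i0 x = p.
  by move=> /(chart_at Mm)[i]; rewrite (i0E i).
have repE (j : idx Q) a : dom j a -> exists2 x, dom i0 x & par i0 x = f' (par j a).
  move=> ja; have [x [ix E]] := cover _ (f'M _ (par_pts Qm ja)).
  by exists x.
pose F (j : idx Q) a := get [set x | dom i0 x /\ par i0 x = f' (par j a)].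
have FE (j : idx Q) a : dom j a -> dom i0 (F j a) /\ par i0 (F j a) = f' (par j a).
  by move=> /repE[x ix E]; exact: (@getPex _ [set x | dom i0 x /\ par i0 x = f' (par j a)]
    (ex_intro _ x (conj ix E))).
have smF (j : idx Q) : smooth_on (dom j) (F j).
  apply: smooth_local => a ja; have [ix E] := FE j a ja.
  have [F0 [U [oU Ua Ui sF0 hF0]]] := sf' j a i0 _ ja ix E.
  exists U; split=> //; apply: (eq_smooth oU _ sF0) => y Uy.
  have [iy Ey] := FE j y (Ui _ Uy); have [iy' Ey'] := hF0 y Uy.
  by apply: ((Mch i0).2 _ _ (mem_set iy') (mem_set iy)); rewrite Ey Ey'.
have lF (j : idx Q) a : dom j a -> local_rep f' j a i0 (F j).
  move=> ja; exists (dom j); split=> //; first exact: (Qch j).1.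
  by move=> x; exact: FE.
have FGid x (j : idx Q) G : local_rep f i0 x j G ->
    F j (G x) = x /\ forall v, 'd (F j) (G x) ('d G x v) = v.
  move=> lG; have [ix jG EG] := local_rep_at lG.
  have [lFG dFG] := local_rep_comp lG (lF _ _ jG).
  have lid : local_rep (f' \o f) i0 x i0 id.
    exists (dom i0); split=> //; first exact: (Mch i0).1.
      by exact: smooth_id.
    by move=> y iy; split=> //=; rewrite ff'//; exact: par_pts.
  have [E dE] := near_diff lid (local_rep_unique (Mch i0).2 lid lFG).
  by split=> [//|v]; rewrite -dFG dE diff_idE.
(* f is represented near F j a by some G, and G \o F j is the identity near a. *)
have GFinj (j : idx Q) a v : dom j a -> 'd (F j) a v = 0 -> v = 0.
  move=> ja Fv; have [ix E] := FE j a ja.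
  have fE : par j a = f (par i0 (F j a)) by rewrite E f'f//; exact: par_pts.
  have [G lG] := sf i0 (F j a) j a ix ja fE.
  have [lGF dGF] := local_rep_comp (lF _ _ ja) lG.
  have lid : local_rep (f \o f') j a j id.
    exists (dom j); split=> //; first exact: (Qch j).1.
      by exact: smooth_id.
    by move=> y iy; split=> //=; rewrite f'f//; exact: par_pts.
  have [_ dE] := near_diff lid (local_rep_unique (Qch j).2 lid lGF).
  have h1 := etrans (dGF v) (congr1 ('d G (F j a)) Fv).
  have h2 := etrans (dE v) (diff_idE a v).
  exact: etrans (esym h2) (etrans h1 (linear0 _)).
(* The Gram matrix of the pullback of h by F j. *)
pose q : metric Q := fun j a =>
  'J (F j) a *m h i0 (F j a) *m ('J (F j) a)^T.
have qE (j : idx Q) a v w : inner q j a v w =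
    inner h i0 (F j a) ('d (F j) a v) ('d (F j) a w).
  have dJ u : 'd (F j) a u = u *m 'J (F j) a by exact: diff_jacobian.
  by rewrite (eq_inner _ _ erefl (dJ v) (dJ w)) /inner /q trmx_mul !mulmxA.
exists q; split; last first.
  apply: (preservesI Qm) => i x j G; rewrite (i0E i) => lG; exists G.
  split; first exact: lG.
  move=> v w.
  have [E dE] := FGid _ _ _ lG.
  exact: etrans (esym (eq_inner h i0 E (dE v) (dE w))) (esym (qE _ _ _ _)).
split; first exact: Qm.
- move=> j; have oj := (Qch j).1.
  have sJ := smooth_jacobian oj (smF j).
  have sh : smooth_on (dom j) (fun a => h i0 (F j a)).
    by apply: (smooth_comp oj _ (smh i0) (smF j)) => x /FE[].
  by move=> k; apply: Ck_mulmx => //; [apply: Ck_mulmx => //|exact: Ck_trmx].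
- move=> j a ja; rewrite /q !trmx_mul trmxK mulmxA symh//.
  exact: (FE _ _ ja).1.
- move=> j a v ja v0; rewrite qE; apply: posh; first exact: (FE _ _ ja).1.
  by apply: contra_neq v0; exact: GFinj.
- apply: (preservesI Qm) => j a k K lK; exists K; split; first exact: lK.
  move=> v w.
  have [ja kK EK] := local_rep_at lK.
  have [lFK dFK] := local_rep_comp lK (lF _ _ kK).
  have [E dE] := near_diff (lF _ _ ja) (local_rep_unique (Mch i0).2 (lF _ _ ja) lFK).
  apply: etrans (qE _ _ _ _) (etrans _ (esym (qE _ _ _ _))).
  by apply: eq_inner; [exact: esym|exact: etrans (esym (dE v)) (dFK v)|
                       exact: etrans (esym (dE w)) (dFK w)].
Qed.

End PushForward.

(** * Products of Riemannian manifolds *)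

Section Products.
Context {R : realType}.

Lemma inner_prod m n T T' (M : manifold R m T) (N : manifold R n T')
    (g : metric M) (h : metric N) ij x v w :
  inner (prod_metric g h) ij x v w =
  inner g ij.1 (lsubmx x) (lsubmx v) (lsubmx w) +
  inner h ij.2 (rsubmx x) (rsubmx v) (rsubmx w).
Proof.
rewrite /inner /prod_metric -{1}(hsubmxK v) -{1}(hsubmxK w) mul_row_block.
by rewrite !mulmx0 addr0 add0r tr_row_mx mul_row_col mxE.
Qed.

Section ProductMaps.
Context {m n m' n' : nat} {T T' U U' : Type}.
Context {M : manifold R m T} {N : manifold R n T'}.
Context {M' : manifold R m' U} {N' : manifold R n' U'}.

Lemma local_rep_prod (f : T -> U) (f' : T' -> U')
    (i : idx M) (i' : idx N) a (j : idx M') (j' : idx N') F F' :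
  local_rep f i (lsubmx a) j F -> local_rep f' i' (rsubmx a) j' F' ->
  let K x := row_mx (F (lsubmx x)) (F' (rsubmx x)) in
  @local_rep R _ _ _ _ (prod_manifold M N) (prod_manifold M' N')
    (fun z => (f z.1, f' z.2)) (i, i') a (j, j') K /\
  forall v, 'd K a v = row_mx ('d F (lsubmx a) (lsubmx v))
                              ('d F' (rsubmx a) (rsubmx v)).
Proof.
move=> lF lF' K; split=> [|v]; last first.
  have dF := local_rep_differentiable lF.
  have dF' := local_rep_differentiable lF'.
  have dl : differentiable (F \o lsubmx) a.
    by apply: differentiable_comp => //; exact: differentiable_lsubmx.
  have dr : differentiable (F' \o rsubmx) a.
    by apply: differentiable_comp => //; exact: differentiable_rsubmx.
  have El : 'd (F \o lsubmx) a v = 'd F (lsubmx a) (lsubmx v).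
    rewrite -[in RHS](diff_lsubmx a v); apply: diff_compE => //.
    exact: differentiable_lsubmx.
  have Er : 'd (F' \o rsubmx) a v = 'd F' (rsubmx a) (rsubmx v).
    rewrite -[in RHS](diff_rsubmx a v); apply: diff_compE => //.
    exact: differentiable_rsubmx.
  exact: etrans (diff_row_mx v dl dr).2 (congr2 row_mx El Er).
case: lF lF' => V [oV Va Vi sF h] [V' [oV' V'a Vi' sF' h']].
have oW : open (lsubmx @^-1` V `&` rsubmx @^-1` V').
  apply: openI; apply: open_comp => // x _.
    exact: continuous_lsubmx.
  exact: continuous_rsubmx.
exists (lsubmx @^-1` V `&` rsubmx @^-1` V'); split=> //.
- by move=> x [/Vi ? /Vi' ?].
- apply: smooth_row_mx => //.
    apply: (smooth_comp oW _ sF) => [x []//|].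
    by apply: smooth_lsubmx => // k; exact: Ck_id.
  apply: (smooth_comp oW _ sF') => [x []//|].
  by apply: smooth_rsubmx => // k; exact: Ck_id.
- move=> x [Vx V'x]; have [? E] := h _ Vx; have [? E'] := h' _ V'x.
  by rewrite /= row_mxKl row_mxKr E E'.
Qed.

Lemma smooth_map_prod (f : T -> U) (f' : T' -> U') :
  smooth_map M M' f -> smooth_map N N' f' ->
  smooth_map (prod_manifold M N) (prod_manifold M' N')
    (fun z => (f z.1, f' z.2)).
Proof.
move=> [fM sf] [fN sf']; split=> [p [/= /fM ? /fN ?]//|].
move=> [i i'] a [j j'] b [/= ia i'a] [/= jb j'b] [E E'].
have [F lF] := sf _ _ _ _ ia jb E; have [F' lF'] := sf' _ _ _ _ i'a j'b E'.
by eexists; exact: (local_rep_prod lF lF').1.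
Qed.

End ProductMaps.

Lemma prod_is_manifold m n T T' (M : manifold R m T) (N : manifold R n T') :
  is_manifold M -> is_manifold N -> is_manifold (prod_manifold M N).
Proof.
move=> [Mch Mpts Mid Mhaus [J [cJ MJ]]] [Nch Npts Nid Nhaus [J' [cJ' NJ']]].
have oprod (A : set 'rV[R]_m) (B : set 'rV[R]_n) : open A -> open B ->
    open (lsubmx @^-1` A `&` rsubmx @^-1` B).
  move=> oA oB; apply: openI; apply: open_comp => // x _.
    exact: continuous_lsubmx.
  exact: continuous_rsubmx.
split.
- move=> [i i']; split; first by apply: oprod; [exact: (Mch i).1|exact: (Nch i').1].
  move=> x y /set_mem[/= ix i'x] /set_mem[/= iy i'y] [E E'].
  rewrite -(hsubmxK x) -(hsubmxK y).
  rewrite ((Mch i).2 _ _ (mem_set ix) (mem_set iy) E).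
  by rewrite ((Nch i').2 _ _ (mem_set i'x) (mem_set i'y) E').
- apply/seteqP; split=> [[p q] [/=]|_ [[i i'] _ [a [/= ia i'a] <-]]].
    rewrite Mpts Npts => -[i _ [a ia <-]] [i' _ [a' ia' <-]].
    exists (i, i') => //; exists (row_mx a a') => /=.
      by rewrite row_mxKl row_mxKr.
    by rewrite row_mxKl row_mxKr.
  by split=> /=; [rewrite Mpts; exists i => //; exists (lsubmx a)|
                  rewrite Npts; exists i' => //; exists (rsubmx a)].
- have := smooth_map_prod Mid Nid; rewrite [X in smooth_map _ _ X](_ : _ = id)//.
  by apply/funext => -[].
- move=> [p q] [p' q'] [/= Mp Nq] [/= Mp' Nq'] pq.
  have [pp'|pp'] := pselect (p = p').
    have qq' : q <> q' by move=> qq'; apply: pq; rewrite pp' qq'.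
    have [A [A' [oA oA' Ap Ap' AA']]] := Nhaus _ _ Nq Nq' qq'.
    exists [set z | A z.2], [set z | A' z.2]; split=> //.
    + move=> [i i']; have := oprod _ _ (Mch i).1 (oA i').
      by congr open; apply/seteqP; split=> z /=; tauto.
    + move=> [i i']; have := oprod _ _ (Mch i).1 (oA' i').
      by congr open; apply/seteqP; split=> z /=; tauto.
    + apply/seteqP; split=> // -[u v] [[/= Av A'v] [/= _ Nv]].
      by rewrite -[False]/(set0 v) -AA'.
  have [A [A' [oA oA' Ap Ap' AA']]] := Mhaus _ _ Mp Mp' pp'.
  exists [set z | A z.1], [set z | A' z.1]; split=> //.
  + move=> [i i']; have := oprod _ _ (oA i) (Nch i').1.
    by congr open; apply/seteqP; split=> z /=; tauto.
  + move=> [i i']; have := oprod _ _ (oA' i) (Nch i').1.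
    by congr open; apply/seteqP; split=> z /=; tauto.
  + apply/seteqP; split=> // -[u v] [[/= Av A'v] [/= Mu _]].
    by rewrite -[False]/(set0 u) -AA'.
- exists (J `*` J'); split; first exact: countableX.
  move=> [p q] [/= /MJ[i Ji [a ia <-]] /NJ'[i' Ji' [a' ia' <-]]].
  exists (i, i') => //; exists (row_mx a a') => /=.
    by rewrite row_mxKl row_mxKr.
  by rewrite row_mxKl row_mxKr.
Qed.

Section ProductMetrics.
Context {m n m' n' : nat} {T T' U U' : Type}.
Context {M : manifold R m T} {N : manifold R n T'}.
Context {M' : manifold R m' U} {N' : manifold R n' U'}.
Variables (g : metric M) (h : metric N) (g' : metric M') (h' : metric N').

Lemma preserves_prod (f : T -> U) (f' : T' -> U') :
  is_manifold M' -> is_manifold N' ->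
  smooth_map M M' f -> smooth_map N N' f' ->
  preserves g g' f -> preserves h h' f' ->
  preserves (prod_metric g h) (prod_metric g' h') (fun z => (f z.1, f' z.2)).
Proof.
move=> Mm Nm [_ sf] [_ sf'] pf pf'; apply: preservesI; first exact: prod_is_manifold.
move=> [i i'] a [j j'] K lK; have [[/= ia i'a] [/= jK j'K] [E E']] := local_rep_at lK.
have [F lF] := sf _ _ _ _ ia jK E; have [F' lF'] := sf' _ _ _ _ i'a j'K E'.
have [lFF dFF] := local_rep_prod lF lF'.
eexists; split; first exact: lFF.
move=> v w; rewrite !dFF !inner_prod /= !row_mxKl !row_mxKr.
by rewrite (pf _ _ _ _ lF) (pf' _ _ _ _ lF').
Qed.

End ProductMetrics.

Lemma riemannian_prod m n T T' (M : manifold R m T) (N : manifold R n T')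
    (g : metric M) (h : metric N) :
  riemannian g -> riemannian h -> riemannian (prod_metric g h).
Proof.
move=> [Mm sg symg posg idg] [Nm sh symh posh idh].
have Pm := prod_is_manifold Mm Nm.
have [charts _ _ _ _] := Pm.
split=> //.
- move=> [i i']; have oD := (charts (i, i')).1.
  have sl : smooth_on (@dom _ _ _ (prod_manifold M N) (i, i'))
      (fun x : 'rV[R]_(m + n) => g i (lsubmx x)).
    apply: (smooth_comp oD _ (sg i)) => [x []//|].
    by apply: smooth_lsubmx => // k; exact: Ck_id.
  have sr : smooth_on (@dom _ _ _ (prod_manifold M N) (i, i'))
      (fun x : 'rV[R]_(m + n) => h i' (rsubmx x)).
    apply: (smooth_comp oD _ (sh i')) => [x []//|].
    by apply: smooth_rsubmx => // k; exact: Ck_id.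
  move=> k; apply/Ck_mxP => // a b; rewrite /prod_metric /=.
  case: (split_ordP a) => a' ->; case: (split_ordP b) => b' ->.
  + by apply: (eq_Ck oD) ((Ck_mxP oD _ _).1 (sl k) a' b') => x _; rewrite block_mxEul.
  + by apply: (eq_Ck oD) (Ck_cst _ k (0 : R)) => x _; rewrite block_mxEur mxE.
  + by apply: (eq_Ck oD) (Ck_cst _ k (0 : R)) => x _; rewrite block_mxEdl mxE.
  + by apply: (eq_Ck oD) ((Ck_mxP oD _ _).1 (sr k) a' b') => x _; rewrite block_mxEdr.
- move=> [i i'] a [/= ia i'a].
  by rewrite /prod_metric tr_block_mx !trmx0 symg// symh.
- move=> [i i'] a v [/= ia i'a] v0; rewrite inner_prod /=.
  have ge0 k (S : Type) (L : manifold R k S) (q : metric L) (j : idx L) b u :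
      (forall i a v, dom i a -> v != 0 -> 0 < inner q i a v v) ->
      dom j b -> 0 <= inner q j b u u.
    move=> posq jb; have [->|u0] := eqVneq u 0; last exact/ltW/posq.
    by rewrite /inner !mul0mx mxE.
  have [l0|l0] := eqVneq (lsubmx v) 0; last first.
    by apply: ltr_pwDl; [exact: posg|exact: ge0].
  apply: ltr_wpDl; first exact: ge0.
  apply: posh => //; apply: contra_neq v0 => r0.
  by rewrite -(hsubmxK v) l0 r0 row_mx0.
- have [_ _ Mid _ _] := Mm; have [_ _ Nid _ _] := Nm.
  have := preserves_prod Mm Nm Mid Nid idg idh.
  rewrite [X in preserves _ _ X](_ : _ = id)//.
  by apply/funext => -[].
Qed.

Lemma riem_isometry_prod m n m' n' T T' U U'
    (M : manifold R m T) (N : manifold R n T')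
    (M' : manifold R m' U) (N' : manifold R n' U')
    (g : metric M) (h : metric N) (g' : metric M') (h' : metric N') f f' :
  riem_isometry g g' f -> riem_isometry h h' f' ->
  riem_isometry (prod_metric g h) (prod_metric g' h')
    (fun z => (f z.1, f' z.2)).
Proof.
move=> [rg rg' [sf [e [se ef fe]]] pf] [rh rh' [sf' [e' [se' ef' fe']]] pf'].
split; try exact: riemannian_prod; last first.
  by apply: preserves_prod => //; [case: rg'|case: rh'].
split; first exact: smooth_map_prod.
exists (fun z => (e z.1, e' z.2)); split.
- exact: smooth_map_prod.
- by move=> [p q] [/= Mp Nq]; rewrite ef// ef'.
- by move=> [p q] [/= Mp Nq]; rewrite fe// fe'.
Qed.

End Products.

Section Pairing.
Context {R : realType}.

Lemma local_rep_pair l m n T U U' (M : manifold R l T) (N : manifold R m U)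
    (N' : manifold R n U') (f : T -> U) (f' : T -> U') (i : idx M) a
    (j : idx N) (j' : idx N') F F' :
  local_rep f i a j F -> local_rep f' i a j' F' ->
  @local_rep R _ _ _ _ M (prod_manifold N N') (fun p => (f p, f' p)) i a (j, j')
    (fun x => row_mx (F x) (F' x)).
Proof.
move=> [V [oV Va Vi sF h]] [V' [oV' V'a V'i sF' h']].
have oW := openI oV oV'.
exists (V `&` V'); split=> //.
- by move=> x [/Vi].
- apply: smooth_row_mx => //; [apply: smooth_subset sF|apply: smooth_subset sF'];
  by move=> x [].
- move=> x [Vx V'x]; have [? E] := h _ Vx; have [? E'] := h' _ V'x.
  by rewrite /= row_mxKl row_mxKr E E'.
Qed.

End Pairing.

(** * Plane, space and circle coordinates *)

Section Plane.
Context {R : realType}.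
Implicit Types (x y v w : 'rV[R]_2).

Lemma row2E0 (a b : R) : row2 a b 0 0 = a. Proof. by rewrite mxE. Qed.
Lemma row2E1 (a b : R) : row2 a b 0 1 = b. Proof. by rewrite mxE. Qed.

Lemma sum2 (F : 'I_2 -> R) : \sum_i F i = F 0 + F 1.
Proof.
by rewrite big_ord_recl big_ord1; congr (_ + F _); apply: val_inj.
Qed.

Lemma ord2P (P : 'I_2 -> Prop) : P 0 -> P 1 -> forall i, P i.
Proof.
move=> P0 P1 [[|[|//]] h]; [move: P0|move: P1];
  by congr P; apply: val_inj.
Qed.

Lemma row2P x y : x 0 0 = y 0 0 -> x 0 1 = y 0 1 -> x = y.
Proof. by move=> h0 h1; apply/rowP; exact: ord2P. Qed.

Definition sqnorm x : R := x 0 0 ^+ 2 + x 0 1 ^+ 2.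
Definition dot v w : R := v 0 0 * w 0 0 + v 0 1 * w 0 1.
Definition cross v w : R := v 0 0 * w 0 1 - v 0 1 * w 0 0.

Lemma sqnorm_ge0 x : 0 <= sqnorm x.
Proof. by rewrite addr_ge0 ?sqr_ge0. Qed.

Lemma sqnorm_eq0 x : (sqnorm x == 0) = (x == 0).
Proof.
apply/eqP/eqP => [/eqP|->]; last by rewrite /sqnorm !mxE expr0n addr0.
rewrite paddr_eq0 ?sqr_ge0// !sqrf_eq0 => /andP[/eqP h0 /eqP h1].
by apply: row2P; rewrite mxE.
Qed.

Lemma enormE x : enorm x = Num.sqrt (sqnorm x).
Proof. by rewrite /enorm sum2. Qed.

Lemma enorm_ge0 x : 0 <= enorm x. Proof. by rewrite enormE sqrtr_ge0. Qed.

Lemma sqr_enorm x : enorm x ^+ 2 = sqnorm x.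
Proof. by rewrite enormE sqr_sqrtr ?sqnorm_ge0. Qed.

Lemma enorm_eq0 x : (enorm x == 0) = (x == 0).
Proof. by rewrite -sqnorm_eq0 -sqr_enorm sqrf_eq0. Qed.

Lemma enorm_gt0 x : (0 < enorm x) = (x != 0).
Proof. by rewrite lt0r enorm_ge0 andbT enorm_eq0. Qed.

Lemma smooth_sqnorm (V : normedModType R) (U : set V) (f : V -> 'rV[R]_2) :
  open U -> smooth_on U f -> smooth_on U (fun z => sqnorm (f z)).
Proof. by move=> oU sf; rewrite /sqnorm; smooth_tac. Qed.

Lemma enorm_continuous : continuous (@enorm R 2).
Proof.
move=> x; rewrite (_ : @enorm R 2 = Num.sqrt \o sqnorm); last first.
  by apply/funext => y; rewrite enormE.
apply: continuous_comp; last exact: sqrt_continuous.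
exact: (smooth_sqnorm openT (@smooth_id R _ setT) 0%N).
Qed.

Lemma open_enorm_lt (r : R) : open [set x : 'rV[R]_2 | enorm x < r].
Proof.
apply: open_comp (@open_lt _ r) => x _; exact: enorm_continuous.
Qed.

Lemma sqnorm_rotation t x : sqnorm (rotation t x) = sqnorm x.
Proof. by rewrite -[RHS]mul1r -(cos2Dsin2 t) /sqnorm !row2E0 !row2E1; ring. Qed.

Lemma enorm_rotation t x : enorm (rotation t x) = enorm x.
Proof. by rewrite !enormE sqnorm_rotation. Qed.

Lemma dot_rotation t v w : dot (rotation t v) (rotation t w) = dot v w.
Proof. by rewrite -[RHS]mul1r -(cos2Dsin2 t) /dot !row2E0 !row2E1; ring. Qed.

Lemma cross_rotation t v w : cross (rotation t v) (rotation t w) = cross v w.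
Proof. by rewrite -[RHS]mul1r -(cos2Dsin2 t) /cross !row2E0 !row2E1; ring. Qed.

Lemma rotationD s t x : rotation (s + t) x = rotation s (rotation t x).
Proof.
by apply: row2P; rewrite !(row2E0, row2E1) cosD sinD; ring.
Qed.

Lemma rotation0 x : rotation 0 x = x.
Proof. by apply: row2P; rewrite !(row2E0, row2E1) cos0 sin0; ring. Qed.

Lemma rotationK t : cancel (rotation t) (@rotation R (- t)).
Proof. by move=> x; rewrite -rotationD addNr rotation0. Qed.

Lemma rotationVK t : cancel (rotation (- t)) (@rotation R t).
Proof. by move=> x; rewrite -rotationD subrr rotation0. Qed.

Lemma smooth_rotation (V : normedModType R) (U : set V) (f : V -> R) (g : V -> 'rV[R]_2) :
  open U -> smooth_on U f -> smooth_on U g ->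
  smooth_on U (fun z => rotation (f z) (g z)).
Proof. by move=> oU sf sg; rewrite /rotation; smooth_tac. Qed.

Lemma rotation_linear t : linear (@rotation R t).
Proof.
move=> a x y; apply: row2P; rewrite !mxE /=; ring.
Qed.

HB.instance Definition _ t := GRing.isLinear.Build R 'rV[R]_2 'rV[R]_2 _
  (@rotation R t) (rotation_linear t).

Lemma diff_rotation t x v : 'd (@rotation R t) x v = rotation t v.
Proof.
rewrite diff_lin// => y.
exact: (smooth_rotation openT (@smooth_cst R _ setT _ t) (@smooth_id R _ setT) 0%N).
Qed.

End Plane.

Section Space.
Context {R : realType}.

Lemma row3E (a b c : R) : [/\ row3 a b c 0 0 = a, row3 a b c 0 1 = b &
  row3 a b c 0 2 = c].
Proof. by split; rewrite mxE. Qed.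

Lemma sum3 (F : 'I_3 -> R) : \sum_i F i = F 0 + F 1 + F 2.
Proof.
rewrite !big_ord_recl big_ord0 addr0 addrA.
by congr (_ + F _ + F _); apply: val_inj.
Qed.

Lemma ord3P (P : 'I_3 -> Prop) : P 0 -> P 1 -> P 2 -> forall i, P i.
Proof.
move=> P0 P1 P2 [[|[|[|//]]] h]; [move: P0|move: P1|move: P2];
  by congr P; apply: val_inj.
Qed.

Lemma row3P (x y : 'rV[R]_3) :
  x 0 0 = y 0 0 -> x 0 1 = y 0 1 -> x 0 2 = y 0 2 -> x = y.
Proof. by move=> h0 h1 h2; apply/rowP; exact: ord3P. Qed.

Lemma smooth_row3 (V : normedModType R) (U : set V) (f g k : V -> R) : open U ->
  smooth_on U f -> smooth_on U g -> smooth_on U k ->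
  smooth_on U (fun x => row3 (f x) (g x) (k x)).
Proof.
move=> oU sf sg sk; apply: smooth_mx => // i; apply: ord3P.
- by apply: (eq_smooth oU _ sf) => x _; rewrite (ord1 i) mxE.
- by apply: (eq_smooth oU _ sg) => x _; rewrite (ord1 i) mxE.
- by apply: (eq_smooth oU _ sk) => x _; rewrite (ord1 i) mxE.
Qed.

End Space.

Section CircleCoordinates.
Context {R : realType}.
Implicit Types (s t : R) (k : int).

Lemma to_S1P s t : to_S1 s = to_S1 t <-> exists k, s = t + k%:~R * (2 * pi).
Proof.
have -> : (to_S1 s = to_S1 t) <-> s - t \in @period R.
  rewrite Quotient.idealrBE; exact: (rwP eqP).
rewrite unfold_in /=; split=> [/asboolP[k E]|[k ->]].
  by exists k; rewrite -E subrKC.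
by apply/asboolP; exists k; rewrite addrAC subrr add0r.
Qed.

Lemma to_S1D s t : to_S1 (s + t) = to_S1 s + to_S1 t.
Proof. exact: raddfD. Qed.

Lemma to_S1N s : to_S1 (- s) = - to_S1 s.
Proof. exact: raddfN. Qed.

Lemma to_S10 : to_S1 (0 : R) = 0.
Proof. exact: raddf0. Qed.

Lemma of_S1K : cancel (@of_S1 R) (@to_S1 R).
Proof. exact: reprK. Qed.

Lemma cos_sin_int k t : cos (t + k%:~R * (2 * pi)) = cos t /\
  sin (t + k%:~R * (2 * pi)) = sin t.
Proof.
have H n (u : R) : cos (u + n%:R * (2 * pi)) = cos u /\ sin (u + n%:R * (2 * pi)) = sin u.
  rewrite (_ : n%:R * (2 * pi) = pi *+ 2 *+ n); last by rewrite mulr_natl [2 * _]mulr_natl.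
  by split; [exact: (periodicn (@cosD2pi R))|exact: (periodicn (@sinD2pi R))].
case: k => n; first exact: H.
have := H n.+1 (t + (Negz n)%:~R * (2 * pi)).
by rewrite NegzE mulrNz mulNr subrK => -[<- <-].
Qed.

Lemma rotation_of_S1 s (x : 'rV[R]_2) : rotation (of_S1 (to_S1 s)) x = rotation s x.
Proof.
have /to_S1P[k ->] := of_S1K (to_S1 s).
by have [hc hs] := cos_sin_int k s; rewrite /rotation hc hs.
Qed.

Lemma two_pi_gt0 : 0 < 2 * pi :> R.
Proof. by rewrite mulr_gt0 ?pi_gt0. Qed.

Lemma S1_rep (p : S1 R) : exists2 s, 0 <= s < 2 * pi & to_S1 s = p.
Proof.
pose t := of_S1 p; pose k := Num.floor (t / (2 * pi)).
exists (t - k%:~R * (2 * pi)); last first.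
  by rewrite -[RHS]of_S1K; apply/to_S1P; exists (- k); rewrite mulrNz mulNr.
have := floor_itv (t / (2 * pi)); rewrite -/k.
rewrite ler_pdivlMr ?two_pi_gt0// ltr_pdivrMr ?two_pi_gt0//.
by rewrite intrD => /andP[h1 h2]; apply/andP; split; lra.
Qed.

(** A representative in [0, 2 pi) is 0 by injectivity of cos on [0, pi],
    applied to s or to 2 pi - s. *)
Lemma cos_eq1 t : cos t = 1 -> to_S1 t = 0.
Proof.
have [s /andP[s0 s2] st] := S1_rep (to_S1 t).
have /to_S1P[k tE] := esym st.
have -> : cos t = cos s by rewrite tE; exact: (cos_sin_int k s).1.
rewrite -st -to_S10 -cos0 => hs; congr to_S1.
have pi0 := pi_gt0 R.
have [spi|spi] := leP s pi.
  by apply: cos_inj hs; rewrite in_itv/= ?lexx ?s0 ?spi// ltW.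
have : cos (2 * pi - s) = cos 0.
  rewrite -hs -cosN opprB; have := (cos_sin_int (-1) s).1.
  by rewrite mulN1r.
move=> /(cos_inj _ _) h; have := h; rewrite !in_itv/= => /(_ _ _).
have h1 : 0 <= 2 * pi - s <= pi by apply/andP; split; lra.
have h2 : 0 <= (0 : R) <= pi by rewrite lexx ltW.
by move=> /(_ h1 h2); lra.
Qed.

Lemma to_S1_inj_lt s t : `|s - t| < 2 * pi -> to_S1 s = to_S1 t -> s = t.
Proof.
move=> st /to_S1P[k E]; suff k0 : k = 0 by rewrite E k0 mul0r addr0.
move: st; rewrite E addrAC subrr add0r normrM (gtr0_norm two_pi_gt0).
rewrite gtr_pMl ?two_pi_gt0// -intr_norm -[1]/(1%:~R) ltr_int.
by move=> h; apply/eqP; rewrite -normr_eq0; lia.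
Qed.

End CircleCoordinates.

(** * The disk and the circle as Riemannian manifolds *)

Section DiskAndCircle.
Context {R : realType}.
Implicit Types r tau : R.

Lemma disk_manifold : is_manifold (disk R).
Proof.
apply: single_chart_manifold; first exact: open_enorm_lt.
  by move=> x y _ _.
by rewrite image_id.
Qed.

(** The disk is parametrized by the identity, so a smooth formula with
    values in the disk represents itself. *)
Lemma local_rep_to_disk m T (M : manifold R m T) (f : T -> 'rV[R]_2)
    (i : idx M) a F :
  open (dom i) -> dom i a -> smooth_on (dom i) F ->
  (forall x, dom i x -> f (par i x) = F x /\ enorm (F x) < pi / 2) ->
  @local_rep R _ _ _ _ M (disk R) f i a tt F.
Proof.
move=> oi ia sF fF; exists (dom i); split=> // x ix.
by have [E Fx] := fF x ix; split=> //=; rewrite E.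
Qed.

(** A real lift phi of f represents f up to a multiple of 2 pi. The multiple
    which is right at a is right as long as the translated lift stays inside
    the chart. *)
Lemma local_rep_to_circle m T (M : manifold R m T) (f : T -> S1 R)
    (i : idx M) a (c : idx (circle R)) (b : 'rV[R]_1) (phi : 'rV[R]_m -> R) :
  open (dom i) -> dom i a -> smooth_on (dom i) phi ->
  (forall x, dom i x -> f (par i x) = to_S1 (phi x)) ->
  dom c b -> par c b = f (par i a) ->
  exists k, local_rep f i a c (fun x => const_mx (phi x + k)).
Proof.
move=> oi ia sphi fphi cb; rewrite fphi//= => /to_S1P[k E].
pose l := k%:~R * (2 * pi) : R; exists l.
pose W := [set t : R | c - l < t] `&` [set t : R | t < c + 2 * pi - l].
have oW : open W.
  by apply: openI; [exact: open_gt|exact: open_lt].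
exists (dom i `&` phi @^-1` W); split.
- apply: (open_preimageI oi oW) => x ix.
  exact/differentiable_continuous/(smooth_differentiable sphi ix).
- by split=> //; move: cb => /= /andP[]; rewrite E -/l /W /=; split; lra.
- by move=> x [].
- have oU : open (dom i `&` phi @^-1` W).
    apply: (open_preimageI oi oW) => x ix.
    exact/differentiable_continuous/(smooth_differentiable sphi ix).
  have sU : smooth_on (dom i `&` phi @^-1` W) phi.
    by apply: smooth_subset sphi => x [].
  apply: smooth_mx => // p q.
  have s1 : smooth_on (dom i `&` phi @^-1` W) (fun x => phi x + l) by smooth_tac.
  by apply: (eq_smooth oU _ s1) => x _; rewrite mxE.
- move=> x [ix [/= h1 h2]]; rewrite !mxE; split; first by apply/andP; split; lra.
  by rewrite fphi//; apply/to_S1P; exists k.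
Qed.

Lemma circle_chart_open (c : idx (circle R)) : open (dom c).
Proof.
have ccont : continuous (fun x : 'rV[R]_1 => x 0 0 : R).
  by move=> x; exact: coord_continuous.
rewrite (_ : dom c = [set x : 'rV[R]_1 | c < x 0 0] `&`
                     [set x : 'rV[R]_1 | x 0 0 < c + 2 * pi]).
  by apply: openI; [apply: open_comp (@open_gt _ c)|
                    apply: open_comp (@open_lt _ (c + 2 * pi))] => x _;
     exact: ccont.
by apply/seteqP; split=> x /=; [move/andP|move=> [-> ->]].
Qed.

Lemma smooth_translation tau :
  smooth_map (circle R) (circle R) (fun s => s + to_S1 tau).
Proof.
split=> // c a d b ca db E.
have oc := @circle_chart_open c.
have [||k ?] := @local_rep_to_circle _ _ (circle R) (fun s => s + to_S1 tau)
    c a d b (fun x => x 0 0 + tau) oc ca _ _ db E.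
- by smooth_tac.
- by move=> x _; rewrite to_S1D.
- by eexists; eassumption.
Qed.

Lemma smooth_circle_id : smooth_map (circle R) (circle R) id.
Proof.
have [h H] := smooth_translation 0; split=> // c a d b ca db E.
have [|F lF] := H c a d b ca db; first by rewrite E to_S10 addr0.
by exists F; apply: eq_local_rep lF => x _; rewrite to_S10 addr0.
Qed.

(** Two charts cover the circle. A point q other than p is separated from p
    by the function cos (s - p), which takes the value 1 only at p. *)
Lemma circle_manifold : is_manifold (circle R).
Proof.
have p0 := two_pi_gt0 (R := R).
have pi0 := pi_gt0 R.
have cover (p : S1 R) : exists2 c, ([set 0; - pi] : set R) c &
    exists2 a : 'rV[R]_1, dom (c : idx (circle R)) a & to_S1 (a 0 0) = p.
  have [s /andP[s0 s2] <-] := S1_rep p.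
  have [->|s1] := eqVneq s 0.
    exists (- pi); first by right.
    by exists 0; rewrite /= mxE//; apply/andP; split; lra.
  exists 0; first by left.
  exists (const_mx s); rewrite /= mxE// add0r s2 andbT lt_neqAle s0 andbT.
  by rewrite eq_sym.
split.
- move=> c; split; first exact: circle_chart_open.
  move=> x y /set_mem /= /andP[x1 x2] /set_mem /= /andP[y1 y2] E.
  apply/rowP => i; rewrite ord1; apply: to_S1_inj_lt E.
  by rewrite ltr_norml; apply/andP; split; lra.
- apply/seteqP; split=> // p _; have [c _ [a ca <-]] := cover p.
  by exists c => //; exists a.
- exact: smooth_circle_id.
- move=> p q _ _ pq.
  pose f (s : S1 R) := cos (of_S1 (s - p)).
  have fE x : f (to_S1 x) = cos (x - of_S1 p).
    rewrite /f -{1}[p]of_S1K -to_S1N -to_S1D.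
    have /to_S1P[k ->] := of_S1K (to_S1 (x - of_S1 p)).
    exact: (cos_sin_int _ _).1.
  have fp : f p = 1 by rewrite -[p in LHS]of_S1K fE subrr cos0.
  have fq : f q < 1.
    rewrite lt_neqAle /f cos_le1 andbT; apply/eqP => /cos_eq1.
    by rewrite of_S1K => /eqP; rewrite subr_eq0 => /eqP qp; exact: pq.
  have open_f (B : set R) : open B -> manifold_open (circle R) [set s | B (f s)].
    move=> oB c; apply: (@open_preimageI 'rV[R]_1 R (fun x => f (to_S1 (x 0 0)))
      (@dom _ _ _ (circle R) c) B (@circle_chart_open c) oB) => x _.
    rewrite (_ : (fun _ => _) = fun y : 'rV[R]_1 => cos (y 0 0 - of_S1 p)).
      have s : smooth_on setT (fun y : 'rV[R]_1 => cos (y 0 0 - of_S1 p)).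
        by have oT := @openT 'rV[R]_1; smooth_tac.
      exact: (s 0%N).
    by apply/funext => y; rewrite fE.
  pose m := (1 + f q) / 2.
  exists [set s | f s > m], [set s | f s < m]; split.
  + exact: (open_f [set r | r > m] (@open_gt _ _)).
  + exact: (open_f [set r | r < m] (@open_lt _ _)).
  + by rewrite /= fp /m; lra.
  + by rewrite /= /m; lra.
  + by apply/seteqP; split=> // s [[/= h1 h2] _]; have := lt_trans h1 h2; rewrite ltxx.
- exists [set 0; - pi]; split; first exact/finite_set_countable/finite_set2.
  move=> p _; have [c hc [a ca <-]] := cover p.
  by exists c => //; exists a.
Qed.

Lemma inner_circle r (c : idx (circle R)) x v w :
  inner (circle_metric r) c x v w = r ^+ 2 * (v 0 0 * w 0 0).
Proof.
by rewrite /inner /circle_metric mul_mx_scalar -scalemxAl !mxE big_ord1 !mxE.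
Qed.

Lemma preserves_translation r tau :
  preserves (circle_metric r) (circle_metric r) (fun s => s + to_S1 tau).
Proof.
apply: preservesI; first exact: circle_manifold.
move=> c a d F lF; have [ca db E] := local_rep_at lF.
have oc := @circle_chart_open c.
have sphi : smooth_on (dom c) (fun x : 'rV[R]_1 => x 0 0 + tau) by smooth_tac.
have [|k lK] := local_rep_to_circle (f := fun s => s + to_S1 tau) oc ca sphi _ db E.
  by move=> x _; rewrite to_S1D.
eexists; split; first exact: lK.
have dphi u : 'd (fun x : 'rV[R]_1 => x 0 0 + tau) a u = u 0 0.
  rewrite -deriveE; last exact: smooth_differentiable sphi ca.
  rewrite deriveD; [|exact/diff_derivable/differentiable_coord|exact: derivable_cst].
  by rewrite derive_cst addr0 derive_coord.
move=> v w; rewrite !diff_const_mx; do ?exact: smooth_differentiable sphi ca.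
by rewrite !inner_circle !dphi !mxE.
Qed.

Lemma riemannian_circle r : r != 0 -> riemannian (circle_metric r).
Proof.
move=> r0; split.
- exact: circle_manifold.
- by move=> c; exact: smooth_cst.
- by move=> c a _; rewrite /circle_metric tr_scalar_mx.
- move=> c a v _ v0; rewrite inner_circle mulr_gt0// ?exprn_even_gt0//.
  rewrite -expr2 exprn_even_gt0//=; apply: contra_neq v0 => h.
  by apply/rowP => j; rewrite ord1 mxE.
- move=> c a d F lF; apply: (@preserves_translation r 0).
  by apply: eq_local_rep lF => x _; rewrite to_S10 addr0.
Qed.

Lemma riem_isometry_translation r (tau : S1 R) : r != 0 ->
  riem_isometry (circle_metric r) (circle_metric r) (fun s => s + tau).
Proof.
move=> r0; rewrite -[tau]of_S1K; have rc := riemannian_circle r0.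
split=> //; last exact: preserves_translation.
split; first exact: smooth_translation.
exists (fun s => s + to_S1 (- of_S1 tau)).
by split; [exact: smooth_translation| |] => s _; rewrite to_S1N ?addrK ?subrK.
Qed.

End DiskAndCircle.

(** * Rotationally symmetric metrics *)

Section RotationallySymmetric.
Context {R : realType}.
Implicit Types (f : R -> R) (x v w : 'rV[R]_2).

(** The coefficient of (x dy - y dx)^2 = (r^2 d theta)^2 in the difference
    with the flat metric. *)
Definition rot_coef f (r : R) : R := (f r ^+ 2 - r ^+ 2) / r ^+ 2 ^+ 2.

Definition quarter_turn x : 'rV[R]_2 := row2 (- x 0 1) (x 0 0).

(** Away from the pole this is d rho^2 + r^2 d theta^2 = dx^2 + dy^2. At the
    pole, the quarter turn of 0 vanishes and both sides are the identity. *)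
Lemma rot_metricE f i x p q : rot_metric f i x p q =
  (p == q)%:R + rot_coef f (enorm x) * (quarter_turn x 0 p * quarter_turn x 0 q).
Proof.
rewrite /rot_metric; case: eqVneq => [->|x0].
  suff -> : quarter_turn 0 = 0 by rewrite !mxE mul0r mulr0 addr0.
  by apply: row2P; rewrite ?row2E0 ?row2E1 !mxE ?oppr0.
have s0 : sqnorm x != 0 by rewrite sqnorm_eq0.
rewrite /rot_coef !mxE !big_ord1 !mxE sqr_enorm.
have -> : (enorm x)^-1 * x 0 p * ((enorm x)^-1 * x 0 q) = x 0 p * x 0 q / sqnorm x.
  by rewrite -sqr_enorm; field; rewrite enorm_eq0.
move: p q; apply: ord2P; apply: ord2P => /=;
  by rewrite /sqnorm /= in s0 *; field.
Qed.

Lemma inner_rot_metric f i x v w : inner (rot_metric f) i x v w =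
  dot v w + rot_coef f (enorm x) * (cross x v * cross x w).
Proof.
rewrite /inner !mxE sum2 !mxE !sum2 !rot_metricE !(row2E0, row2E1) /=.
rewrite /dot /cross; ring.
Qed.

Lemma dot_cross x v w : sqnorm x * dot v w = dot x v * dot x w + cross x v * cross x w.
Proof. by rewrite /sqnorm /dot /cross; ring. Qed.

(** The condition under which the metric of profile f is smooth at the pole. *)
Definition smooth_profile f (phi : R -> R) : Prop :=
  exists D : set R, [/\ open D, smooth_on D phi &
    forall r, 0 <= r < pi / 2 ->
      D (r ^+ 2) /\ f r ^+ 2 = r ^+ 2 * (1 + r ^+ 2 * phi (r ^+ 2))].

Lemma rot_coef_profile f phi r : smooth_profile f phi -> 0 < r < pi / 2 ->
  rot_coef f r = phi (r ^+ 2).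
Proof.
move=> [D [_ _ h]] /andP[r0 r1].
have [|_ E] := h r; first by rewrite ltW.
by rewrite /rot_coef E; field; rewrite gt_eqF.
Qed.

(** Positivity: by Lagrange's identity, |x|^2 times the squared length of v
    is (x . v)^2 + (f^2 / |x|^2) (x ^ v)^2. *)
Lemma riemannian_rot_metric f phi : smooth_profile f phi ->
  (forall r, 0 < r < pi / 2 -> f r != 0) -> riemannian (rot_metric f).
Proof.
move=> pf f0.
have coefE i x p q : dom (i : idx (disk R)) x ->
    rot_metric f i x p q = (p == q)%:R +
      phi (sqnorm x) * (quarter_turn x 0 p * quarter_turn x 0 q).
  move=> /= x1; rewrite rot_metricE; congr (_ + _).
  have [->|x0] := eqVneq x 0.
    suff -> : quarter_turn 0 = 0 by rewrite !mxE mul0r !mulr0.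
    by apply: row2P; rewrite ?row2E0 ?row2E1 !mxE ?oppr0.
  by rewrite (rot_coef_profile pf) ?sqr_enorm// enorm_gt0 x0.
split.
- exact: disk_manifold.
- move=> i; have oD : open (dom (i : idx (disk R))) by exact: open_enorm_lt.
  have [D [oD' sphi h]] := pf.
  apply: smooth_mx => // p q.
  have s : smooth_on (dom i) (fun x => (p == q)%:R +
      phi (sqnorm x) * (quarter_turn x 0 p * quarter_turn x 0 q)).
    have s1 : smooth_on (dom i) (fun x : 'rV[R]_2 => phi (sqnorm x)).
      apply: (smooth_comp_real oD _ sphi).
        move=> x /= x1; rewrite -sqr_enorm.
        by have [] := h (enorm x); rewrite ?enorm_ge0.
      by apply: smooth_sqnorm => //; exact: smooth_id.
    by rewrite /quarter_turn; smooth_tac.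
  by apply: (eq_smooth oD _ s) => x ix; rewrite coefE.
- move=> i a ia; apply/matrixP => p q; rewrite mxE !rot_metricE eq_sym.
  by rewrite [quarter_turn a 0 q * _]mulrC.
- move=> i a v ia v0; rewrite inner_rot_metric.
  have dotv : dot v v = sqnorm v by rewrite /dot /sqnorm -!expr2.
  have v1 : 0 < sqnorm v by rewrite lt0r sqnorm_ge0 sqnorm_eq0 v0.
  have [->|a0] := eqVneq a 0.
    by rewrite dotv /cross !mxE !mul0r subr0 mul0r mulr0 addr0.
  have r0 : 0 < enorm a by rewrite enorm_gt0.
  have fr0 : f (enorm a) != 0 by apply: f0; rewrite r0.
  have s0 : 0 < sqnorm a by rewrite -sqr_enorm exprn_gt0.
  have -> : dot v v + rot_coef f (enorm a) * (cross a v * cross a v) =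
    (dot a v ^+ 2 + f (enorm a) ^+ 2 / sqnorm a * cross a v ^+ 2) / sqnorm a.
    have := dot_cross a v v; rewrite /rot_coef sqr_enorm => h.
    have -> : dot v v = (dot a v * dot a v + cross a v * cross a v) / sqnorm a.
      by rewrite -h; field; rewrite gt_eqF.
    by field; rewrite gt_eqF.
  have q0 : 0 <= f (enorm a) ^+ 2 / sqnorm a * cross a v ^+ 2.
    by rewrite mulr_ge0 ?sqr_ge0// divr_ge0 ?sqr_ge0// ltW.
  rewrite divr_gt0// lt0r addr_ge0 ?sqr_ge0// andbT paddr_eq0 ?sqr_ge0//.
  apply/negP => /andP[]; rewrite expf_eq0 => /= /eqP h1.
  rewrite mulf_eq0 => /orP[|]; first by rewrite gt_eqF// divr_gt0// exprn_even_gt0.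
  rewrite expf_eq0 => /= /eqP h2.
  have := dot_cross a v v; rewrite h1 h2 !mul0r addr0 dotv => /eqP.
  by rewrite mulf_eq0 !gt_eqF.
- apply: preservesI; first exact: disk_manifold.
  move=> [] a [] F lF; exists id; have [ia _ _] := local_rep_at lF.
  split; last by move=> v w; rewrite !diff_idE.
  apply: local_rep_to_disk => //; first exact: open_enorm_lt.
  exact: smooth_id.
Qed.

Lemma rotation_local_rep t (a : 'rV[R]_2) : enorm a < pi / 2 ->
  @local_rep R _ _ _ _ (disk R) (disk R) (rotation t) tt a tt (rotation t).
Proof.
move=> a1; have oD := @open_enorm_lt R (pi / 2).
apply: local_rep_to_disk => //.
  by apply: smooth_rotation => //; smooth_tac.
by move=> x ix; rewrite enorm_rotation.
Qed.

Lemma riem_isometry_rotation f phi t : smooth_profile f phi ->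
  (forall r, 0 < r < pi / 2 -> f r != 0) ->
  riem_isometry (rot_metric f) (rot_metric f) (rotation t).
Proof.
move=> pf f0; have rf := riemannian_rot_metric pf f0.
have srot u : smooth_map (disk R) (disk R) (rotation u).
  split=> [p|[] a [] b ia _ _]; first by rewrite /= enorm_rotation.
  by exists (rotation u); exact: rotation_local_rep.
split=> //.
  split=> //; exists (rotation (- t)).
  by split=> // p _; rewrite ?rotationK ?rotationVK.
apply: preservesI; first exact: disk_manifold.
move=> [] a [] F lF; exists (rotation t); have [ia _ _] := local_rep_at lF.
split; first exact: rotation_local_rep.
move=> v w; rewrite !diff_rotation !inner_rot_metric enorm_rotation.
by rewrite dot_rotation !cross_rotation.
Qed.

(** With C = cos_sqrt u and S = sinc_sqrt u, tan^2 rho = u S^2 / C^2, so phi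
    = (S^2 - C^2) / (u C^2), and (S - C) / u is the entire function
    [sinc_sqrt1 u - cos_sqrt1 u]. *)
Lemma tan_profile : smooth_profile (@tan R) (fun u =>
  (sinc_sqrt1 u - cos_sqrt1 u) * (sinc_sqrt u + cos_sqrt u) / cos_sqrt u ^+ 2).
Proof.
(* cos_sqrt does not vanish for 0 <= u < (pi / 2)^2. *)
pose D := [set u : R | cos_sqrt u != 0].
have oD : open D.
  apply: open_comp (@open_neq _ 0) => u _; exact: (@smooth_cos_sqrt R 0%N).
have sub : D `<=` setT by [].
have s1 := smooth_subset sub (@smooth_sinc_sqrt1 R).
have s2 := smooth_subset sub (@smooth_cos_sqrt1 R).
have s3 := smooth_subset sub (@smooth_sinc_sqrt R).
have s4 := smooth_subset sub (@smooth_cos_sqrt R).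
exists D; split=> //.
  apply: smoothM => //; first by smooth_tac.
  by apply: smoothV => [//|u Du|]; [rewrite expf_neq0|smooth_tac].
move=> r /andP[r0 r1]; have c0 : cos r != 0.
  rewrite gt_eqF// cos_gt0_pihalf// r1 andbT (lt_le_trans _ r0)// oppr_lt0.
  by rewrite divr_gt0 ?pi_gt0.
split; first by rewrite /D/= cos_sqrtE.
rewrite /tan -sinc_sqrtE -cos_sqrtE in c0 *.
move: c0 (sinc_sqrt1E (r ^+ 2)) (cos_sqrt1E (r ^+ 2)).
move: (sinc_sqrt _) (cos_sqrt _) => S C C0 ES EC.
have h : r ^+ 2 * (sinc_sqrt1 (r ^+ 2) - cos_sqrt1 (r ^+ 2)) = S - C.
  by rewrite ES EC; ring.
have -> : r ^+ 2 * ((sinc_sqrt1 (r ^+ 2) - cos_sqrt1 (r ^+ 2)) * (S + C) / C ^+ 2)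
   = (S - C) * (S + C) / C ^+ 2 by rewrite !mulrA h.
by field.
Qed.

(** With S = sinc_sqrt u, sin^2 rho = u S^2, so phi = (S^2 - 1) / u. *)
Lemma sin_profile : smooth_profile (@sin R) (fun u =>
  sinc_sqrt1 u * (sinc_sqrt u + 1)).
Proof.
exists setT; split; first exact: openT.
  have oT := @openT R; have s1 := @smooth_sinc_sqrt1 R.
  by have s3 := @smooth_sinc_sqrt R; smooth_tac.
move=> r _; split=> //; rewrite -sinc_sqrtE.
have := sinc_sqrt1E (r ^+ 2); move: (sinc_sqrt _) => S ES.
have h : r ^+ 2 * sinc_sqrt1 (r ^+ 2) = S - 1 by rewrite ES; ring.
by rewrite mulrA h; ring.
Qed.

Lemma sin_neq0 (r : R) : 0 < r < pi / 2 -> sin r != 0.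
Proof. by move=> h; rewrite gt_eqF// sin_gt0_pihalf. Qed.

Lemma cos_gt0_quarter (r : R) : 0 <= r < pi / 2 -> 0 < cos r.
Proof.
move=> /andP[r0 r1]; rewrite cos_gt0_pihalf// r1 andbT (lt_le_trans _ r0)//.
by rewrite oppr_lt0 divr_gt0 ?pi_gt0.
Qed.

Lemma tan_neq0 (r : R) : 0 < r < pi / 2 -> tan r != 0.
Proof.
move=> /andP[r0 r1]; rewrite /tan mulf_neq0 ?invr_neq0// ?sin_neq0 ?r0//.
by rewrite gt_eqF// cos_gt0_quarter// ltW.
Qed.

End RotationallySymmetric.

(** * The diagonal action and its slice *)

Section DiagonalAction.
Context {R : realType}.
Notation act := (@diag_action R).
Notation D := (disk_circle R).

Lemma disk_circle_manifold : is_manifold D.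
Proof. exact: prod_is_manifold disk_manifold circle_manifold. Qed.

Lemma act0 p : act 0 p = p.
Proof.
case: p => x s.
by rewrite /diag_action -to_S10 rotation_of_S1 rotation0 to_S10 addr0.
Qed.

Lemma actD s t p : act (s + t) p = act s (act t p).
Proof.
case: p => x u; rewrite /diag_action /= -[s]of_S1K -[t]of_S1K -to_S1D !rotation_of_S1.
by rewrite rotationD to_S1D addrA addrAC.
Qed.

(** In coordinates the action is (t, x, s) |-> (R_t x, s + t), because
    rotations do not see multiples of 2 pi. *)
Lemma smooth_action :
  smooth_map (prod_manifold (circle R) D) D (fun z => act z.1 z.2).
Proof.
have Pm := prod_is_manifold (@circle_manifold R) disk_circle_manifold.
split=> [[s [x t]] [_ [/= x1 _]]|].
  by split=> //=; rewrite enorm_rotation.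
move=> [c [[] c']] a [[] d] b ia [/= b1 db] [Eb1 Eb2].
have oi : open (@dom _ _ _ (prod_manifold (circle R) D) (c, (tt, c'))).
  by have [ch _ _ _ _] := Pm; exact: (ch _).1.
have s1 : smooth_on (@dom _ _ _ (prod_manifold (circle R) D) (c, (tt, c')))
    (fun x => rotation (lsubmx x 0 0) (lsubmx (rsubmx x))).
  by apply: smooth_rotation => //; smooth_tac.
have s2 : smooth_on (@dom _ _ _ (prod_manifold (circle R) D) (c, (tt, c')))
    (fun x => (rsubmx (rsubmx x)) 0 0 + (lsubmx x) 0 0).
  by smooth_tac.
have l1 := @local_rep_to_disk _ _ _ (prod_manifold (circle R) D)
  (fun z => rotation (of_S1 z.1) z.2.1) (c, (tt, c')) a _ oi ia s1.
have [|k l2] := @local_rep_to_circle _ _ _ (prod_manifold (circle R) D)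
  (fun z => z.2.2 + z.1) (c, (tt, c')) a d (rsubmx b) _ oi ia s2 _ db Eb2.
  by move=> x _ /=; rewrite to_S1D.
eexists; apply: local_rep_pair l2; apply: l1.
move=> x [/= _ [x1 _]]; rewrite rotation_of_S1 enorm_rotation; split=> //.
Qed.

(** An element acts as the product of a rotation of the disk and a
    translation of the circle. It acts freely already on the circle factor. *)
Lemma diag_action_free_isometric f phi : smooth_profile f phi ->
  (forall r, 0 < r < pi / 2 -> f r != 0) ->
  free_isometric_action (prod_metric (rot_metric f) (circle_metric (1 : R))) act.
Proof.
move=> pf f0; split.
- exact: smooth_action.
- by move=> p _; exact: act0.
- by move=> s t p _; exact: actD.
- move=> s; apply: (@riem_isometry_prod _ _ _ _ _ _ _ _ _ _ _ _ _ _ _ _ _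
    (rotation (of_S1 s)) (fun t => t + s)).
    exact: riem_isometry_rotation pf f0.
  by apply: riem_isometry_translation; exact: oner_neq0.
- by move=> s [x t] _ [_ /eqP]; rewrite -subr_eq0 addrAC subrr add0r => /eqP.
Qed.

Lemma orbit_act t p : act_orbit act (act t p) = act_orbit act p.
Proof.
apply/seteqP; split=> _ [s _ <-]; first by exists (s + t) => //; rewrite actD.
by exists (s - t) => //; rewrite -actD subrK.
Qed.

(** The point where the orbit of p meets the slice s = 0. *)
Definition slice_proj (p : 'rV[R]_2 * S1 R) : 'rV[R]_2 :=
  rotation (of_S1 (- p.2)) p.1.

(** Acting by - s moves (x, s) to the slice without changing its orbit. *)
Lemma orbit_slice : act_orbit act = @to_quotient R \o slice_proj.
Proof.
apply/funext => -[x s]; rewrite /= /to_quotient -[LHS](orbit_act (- s)).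
by congr (act_orbit act (_, _)); exact: addrN.
Qed.

Lemma to_quotient_inj : injective (@to_quotient R).
Proof.
move=> x y E; have : to_quotient y (y, 0) by exists 0 => //; exact: act0.
rewrite -E => -[s _ [Ex /eqP]]; rewrite add0r => /eqP s0.
by move: Ex; rewrite s0 -to_S10 rotation_of_S1 rotation0.
Qed.

(** The expression of [slice_proj] in every chart of the product. *)
Definition slice_rep (x : 'rV[R]_(2 + 1)) : 'rV[R]_2 :=
  rotation (- (rsubmx x) 0 0) (lsubmx x).

Lemma slice_proj_rep (i : idx D) a : dom i a ->
  @local_rep R _ _ _ _ D (disk R) slice_proj i a tt slice_rep.
Proof.
case: i => -[] c ia.
have oi : open (@dom _ _ _ D (tt, c)).
  by have [ch _ _ _ _] := disk_circle_manifold; exact: (ch _).1.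
apply: local_rep_to_disk => //.
  by apply: smooth_rotation => //; smooth_tac.
move=> x [/= x1 _]; rewrite enorm_rotation; split=> //.
by rewrite /slice_proj /= -to_S1N rotation_of_S1.
Qed.

Lemma smooth_section : smooth_map (disk R) D (fun x => (x, 0)).
Proof.
split=> [x x1|]; first by split.
move=> [] a [[] d] b ia [/= b1 db] [Eb1 Eb2].
have oi : open (@dom _ _ _ (disk R) tt) by exact: open_enorm_lt.
have l1 := @local_rep_to_disk _ _ _ (disk R) id tt a _ oi ia (@smooth_id R _ _).
have [|k l2] := @local_rep_to_circle _ _ _ (disk R) (fun=> 0) tt a d (rsubmx b)
  (fun=> 0) oi ia (@smooth_cst R _ _ _ _) _ db Eb2.
  by move=> x _; rewrite to_S10.
by eexists; apply: local_rep_pair l2; apply: l1.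
Qed.

(** The chart of the circle that starts at - pi contains the origin, hence
    covers the slice. *)
Lemma slice_point x : enorm x < pi / 2 -> exists (i : idx D) a,
  [/\ dom i a, slice_rep a = x & lsubmx a = x /\ rsubmx a = 0].
Proof.
move=> x1; have p0 := pi_gt0 R.
exists (tt, - pi), (row_mx x 0); rewrite /slice_rep /= row_mxKl row_mxKr !mxE.
split=> //; last by rewrite oppr0 rotation0.
by split=> //; apply/andP; split; lra.
Qed.

End DiagonalAction.

(** * Horizontal vectors and the quotient metric *)

Section HorizontalLifts.
Context {R : realType}.
Notation D := (disk_circle R).
Notation gM := (prod_metric (rot_metric (@tan R)) (circle_metric (1 : R)) : metric D).
Notation h := (rot_metric (@sin R)).

(** The rotation field: the derivative of R_t x in t is R_t (J x), where J
    is the quarter turn. *)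
Lemma diff_slice_rep (a v : 'rV[R]_(2 + 1)) :
  'd (@slice_rep R) a v = rotation (- (rsubmx a) 0 0)
    (lsubmx v - (rsubmx v) 0 0 *: quarter_turn (lsubmx a)).
Proof.
have oT := @openT 'rV[R]_(2 + 1).
have sT : smooth_on setT (@slice_rep R).
  by apply: smooth_rotation => //; smooth_tac.
have dT : differentiable (@slice_rep R) a by exact: smooth_differentiable sT I.
have hr : is_derive a v (fun x : 'rV[R]_(2 + 1) => - (rsubmx x) 0 0)
    (- (rsubmx v) 0 0).
  rewrite (_ : (fun x => _) = (fun x : 'rV[R]_(2 + 1) => - x 0 (rshift 2 0))).
    by rewrite mxE; apply: is_deriveN; exact: is_derive_coord.
  by apply/funext => x; rewrite mxE.
have dr : differentiable (fun x : 'rV[R]_(2 + 1) => - (rsubmx x) 0 0) a.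
  have s : smooth_on setT (fun x : 'rV[R]_(2 + 1) => - (rsubmx x) 0 0) by smooth_tac.
  exact: smooth_differentiable s I.
have hl j : is_derive a v (fun x : 'rV[R]_(2 + 1) => (lsubmx x) 0 j) ((lsubmx v) 0 j).
  rewrite (_ : (fun x => _) = (fun x : 'rV[R]_(2 + 1) => x 0 (lshift 1 j))).
    by rewrite mxE; exact: is_derive_coord.
  by apply/funext => x; rewrite mxE.
have hc := is_derive_comp_real dr hr (is_derive_cos _).
have hs := is_derive_comp_real dr hr (is_derive_sin _).
rewrite -deriveE//; apply: row2P; rewrite derive_mxE//.
  rewrite (_ : (fun y => _) = fun x => cos (- (rsubmx x) 0 0) * (lsubmx x) 0 0
     - sin (- (rsubmx x) 0 0) * (lsubmx x) 0 1); last first.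
    by apply/funext => x; rewrite row2E0.
  have [_ E] := is_deriveB (is_deriveM hc (hl 0)) (is_deriveM hs (hl 1)).
  apply: etrans E _; rewrite row2E0 /quarter_turn !mxE /= /GRing.scale /=; ring.
rewrite (_ : (fun y => _) = fun x => sin (- (rsubmx x) 0 0) * (lsubmx x) 0 0
   + cos (- (rsubmx x) 0 0) * (lsubmx x) 0 1); last first.
  by apply/funext => x; rewrite row2E1.
have [_ E] := is_deriveD (is_deriveM hs (hl 0)) (is_deriveM hc (hl 1)).
apply: etrans E _; rewrite row2E1 /quarter_turn !mxE /= /GRing.scale /=; ring.
Qed.

Lemma inner_rot_rotation (f : R -> R) i t x v w :
  inner (rot_metric f) i (rotation t x) (rotation t v) (rotation t w) =
  inner (rot_metric f) i x v w.
Proof.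
by rewrite !inner_rot_metric enorm_rotation dot_rotation !cross_rotation.
Qed.

(** Orthogonality to the kernel of the differential of the slice projection,
    which is the orbit direction. *)
Definition horizontal (i : idx D) a v :=
  forall u, 'd (@slice_rep R) a u = 0 -> inner gM i a u v = 0.

(** The factor such that g (J x, v) = tilt x * cross x v, where J x is the
    quarter turn of x; away from the pole it is tan^2 rho / rho^2. *)
Definition tilt (x : 'rV[R]_2) : R := 1 + rot_coef (@tan R) (enorm x) * sqnorm x.

Lemma inner_gM (i : idx D) a u v : inner gM i a u v =
  dot (lsubmx u) (lsubmx v) + rot_coef (@tan R) (enorm (lsubmx a)) *
    (cross (lsubmx a) (lsubmx u) * cross (lsubmx a) (lsubmx v))
  + (rsubmx u) 0 0 * (rsubmx v) 0 0.
Proof.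
by rewrite inner_prod inner_rot_metric inner_circle expr1n mul1r.
Qed.

Lemma inner_gM_vertical (i : idx D) a u v c :
  lsubmx u = c *: quarter_turn (lsubmx a) -> (rsubmx u) 0 0 = c ->
  inner gM i a u v =
  c * (tilt (lsubmx a) * cross (lsubmx a) (lsubmx v) + (rsubmx v) 0 0).
Proof.
rewrite inner_gM => -> ->; rewrite /tilt /dot /cross /sqnorm /quarter_turn !mxE /=.
ring.
Qed.

(** The kernel of the differential is spanned by the orbit direction (J x,
    1), where J x is the quarter turn of x, so horizontality is the single
    equation v_s + g (J x, v_x) = 0. *)
Lemma horizontalP (i : idx D) a v : horizontal i a v <->
  (rsubmx v) 0 0 = - (tilt (lsubmx a) * cross (lsubmx a) (lsubmx v)).
Proof.
split=> [hv|E u].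
  pose u := row_mx (quarter_turn (lsubmx a)) (const_mx 1) : 'rV[R]_(2 + 1).
  have := hv u; rewrite (@inner_gM_vertical _ _ _ _ 1); last 2 first.
  - by rewrite /u row_mxKl scale1r.
  - by rewrite /u row_mxKr mxE.
  rewrite mul1r diff_slice_rep /u row_mxKl row_mxKr [const_mx _ 0 0]mxE scale1r subrr linear0.
  by move=> /(_ erefl) /eqP; rewrite addrC addr_eq0 => /eqP.
rewrite diff_slice_rep => /(congr1 (rotation ((rsubmx a) 0 0))).
rewrite rotationVK linear0 => /eqP; rewrite subr_eq0 => /eqP lu.
by rewrite (inner_gM_vertical i v lu erefl) E subrr mulr0.
Qed.

Lemma tilt_tan x : tilt x * sqnorm x = tan (enorm x) ^+ 2 \/ x = 0.
Proof.
have [->|x0] := eqVneq x 0; [by right|left].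
rewrite /tilt /rot_coef sqr_enorm; field.
by rewrite sqnorm_eq0.
Qed.

(** Up to a rotation, a horizontal vector (v, c) projects to v + q (x ^ v) J
    x with q = tilt x. Comparing the coefficients of (x ^ v) (x ^ w) leaves
    one identity in rho, which is sin^2 = tan^2 / (1 + tan^2) after clearing
    denominators. At the pole both forms are the Euclidean one. *)
Lemma slice_horizontal_isometry (i : idx D) a j v w : dom i a ->
  horizontal i a v -> horizontal i a w ->
  inner h j (slice_rep a) ('d (@slice_rep R) a v) ('d (@slice_rep R) a w) =
  inner gM i a v w.
Proof.
case: i => [[] c] [/= a1 _] /horizontalP Ev /horizontalP Ew.
rewrite !diff_slice_rep inner_rot_rotation Ev Ew inner_rot_metric inner_gM Ev Ew.
set x := lsubmx a in a1 *; set v' := lsubmx v; set w' := lsubmx w.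
set q := tilt x; rewrite !scaleNr !opprK.
have dE : dot (v' + (q * cross x v') *: quarter_turn x)
              (w' + (q * cross x w') *: quarter_turn x) =
    dot v' w' + (2 * q + q ^+ 2 * sqnorm x) * (cross x v' * cross x w').
  by rewrite /dot /cross /sqnorm /quarter_turn !mxE /=; ring.
have cE u : cross x (u + (q * cross x u) *: quarter_turn x) =
    (1 + q * sqnorm x) * cross x u.
  by rewrite /cross /sqnorm /quarter_turn !mxE /=; ring.
rewrite dE !cE.
have [x0|x0] := eqVneq x 0; first by rewrite x0 /cross !mxE; ring.
have s0 : sqnorm x != 0 by rewrite sqnorm_eq0.
have c0 : cos (enorm x) != 0 by rewrite gt_eqF// cos_gt0_quarter// enorm_ge0.
(* The identity between the coefficients of the two cross products. *)
suff key : 2 * q + q ^+ 2 * sqnorm x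
    + rot_coef (@sin R) (enorm x) * (1 + q * sqnorm x) ^+ 2
    = rot_coef (@tan R) (enorm x) + q ^+ 2.
  transitivity (dot v' w' + (2 * q + q ^+ 2 * sqnorm x
    + rot_coef (@sin R) (enorm x) * (1 + q * sqnorm x) ^+ 2)
      * (cross x v' * cross x w')); first by ring.
  by rewrite key; ring.
have -> : q = tan (enorm x) ^+ 2 / sqnorm x.
  by have [E|E] := tilt_tan x; [rewrite -E mulfK|case/eqP: x0].
rewrite /rot_coef sqr_enorm /tan.
have -> : sin (enorm x) ^+ 2 = 1 - cos (enorm x) ^+ 2 by exact: sin2cos2.
rewrite expr_div_n sin2cos2.
by field; rewrite s0 c0.
Qed.

(** One must solve l + q (x ^ l) J x = y for l; since x ^ J x = |x|^2, this
    is possible with l = y - mu J x because 1 + q |x|^2 = 1 + tan^2 rho is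
    not zero. *)
Lemma slice_horizontal_lift (i : idx D) a w : dom i a ->
  exists2 v, horizontal i a v & 'd (@slice_rep R) a v = w.
Proof.
case: i => [[] c] ia; set x := lsubmx a; set s := (rsubmx a) 0 0.
pose y := rotation s w; pose q := tilt x.
have pos : 1 + q * sqnorm x != 0.
  rewrite gt_eqF//; have [->|x0] := tilt_tan x; first by rewrite ltr_pwDl// sqr_ge0.
  by rewrite x0 (eqP (_ : sqnorm 0 == 0)) ?sqnorm_eq0// mulr0 addr0.
(* The solution of - mu + q (x ^ y - mu |x|^2) = 0. *)
pose mu := q * cross x y / (1 + q * sqnorm x).
pose l := y - mu *: quarter_turn x.
pose v := row_mx l (const_mx (- (q * cross x l))) : 'rV[R]_(2 + 1).
exists v; first by apply/horizontalP; rewrite /v row_mxKl row_mxKr mxE.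
rewrite diff_slice_rep /v row_mxKl row_mxKr [const_mx _ 0 0]mxE -/x -/s.
rewrite -[RHS](rotationK s); congr (rotation (- s) _).
rewrite scaleNr opprK /l -addrA -[RHS]addr0; congr (_ + _).
rewrite addrC -scalerBl -[RHS](scale0r (quarter_turn x)); congr (_ *: _).
have -> : cross x (y - mu *: quarter_turn x) = cross x y - mu * sqnorm x.
  by rewrite /cross /sqnorm /quarter_turn !mxE /=; ring.
by rewrite /mu; field.
Qed.

End HorizontalLifts.

Section Upsilon.
Context {R : realType}.
Notation act := (@diag_action R).
Notation D := (disk_circle R).
Notation gM := (prod_metric (rot_metric (@tan R)) (circle_metric (1 : R)) : metric D).
Notation h := (rot_metric (@sin R)).

Lemma riemannian_tan : riemannian (rot_metric (@tan R)).
Proof. exact: riemannian_rot_metric tan_profile (@tan_neq0 R). Qed.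

Lemma riemannian_sin : riemannian h.
Proof. exact: riemannian_rot_metric sin_profile (@sin_neq0 R). Qed.

(** The orbit space is the disk itself, with [to_quotient] as its only
    parametrization. *)
Lemma orbit_space_exists :
  exists Q : manifold R 2 (set ('rV[R]_2 * S1 R)), quotient_manifold D act Q.
Proof.
pose B := [set x : 'rV[R]_2 | enorm x < pi / 2].
pose Q := @Manifold R 2 _ (@to_quotient R @` B) unit (fun=> B) (fun=> @to_quotient R).
have Qm : is_manifold Q.
  apply: single_chart_manifold => //; first exact: open_enorm_lt.
  by move=> x y _ _; exact: to_quotient_inj.
have lslice (i : idx D) a : dom i a ->
    @local_rep R _ _ _ _ D Q (act_orbit act) i a tt (@slice_rep R).
  move=> /slice_proj_rep[U [oU Ua Ui sF hF]]; exists U; split=> // x Ux.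
  have [? E] := hF x Ux; split=> //.
  by rewrite orbit_slice /= -E.
exists Q; split=> //.
  apply/seteqP; split=> [_ [x Bx <-]|_ [p Dp <-]]; first by exists (x, 0).
  exists (slice_proj p); last by rewrite orbit_slice.
  by rewrite /B /= enorm_rotation; case: Dp.
split.
  split=> [p Dp|i a [] b ia _ _]; last by exists (@slice_rep R); exact: lslice.
  exists (slice_proj p); last by rewrite orbit_slice.
  by rewrite /B /= enorm_rotation; case: Dp.
move=> i a [] F lF w; have [ia _ _] := local_rep_at lF.
have [v _ Ev] := slice_horizontal_lift w ia; exists v.
have [Qch _ _ _ _] := Qm.
have [_ dE] := near_diff lF (local_rep_unique (Qch tt).2 lF (lslice _ _ ia)).
by rewrite -dE.
Qed.

Section OrbitSpace.
Variable Q : manifold R 2 (set ('rV[R]_2 * S1 R)).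
Hypothesis hQ : quotient_manifold D act Q.

Lemma smooth_to_quotient : smooth_map (disk R) Q (@to_quotient R).
Proof.
have [Qm _ [sub _]] := hQ.
exact: (smooth_map_comp disk_manifold disk_circle_manifold smooth_section sub).
Qed.

Lemma orbit_rep x (j : idx Q) G (i : idx D) a :
  @local_rep R _ _ _ _ (disk R) Q (@to_quotient R) tt x j G ->
  dom i a -> slice_rep a = x ->
  local_rep (act_orbit act) i a j (G \o @slice_rep R) /\
  forall v, 'd (G \o @slice_rep R) a v = 'd G (slice_rep a) ('d (@slice_rep R) a v).
Proof.
move=> lG ia ax; rewrite -ax in lG.
by have := local_rep_comp (slice_proj_rep ia) lG; rewrite -orbit_slice.
Qed.

(** If G represents [to_quotient], then G composed with the slice projection
    represents the orbit map, whose differential is onto. *)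
Lemma to_quotient_diff_surj x (j : idx Q) G :
  @local_rep R _ _ _ _ (disk R) Q (@to_quotient R) tt x j G ->
  forall w, exists v, 'd G x v = w.
Proof.
move=> lG w; have [/= x1 _ _] := local_rep_at lG.
have [i [a [ia ax _]]] := slice_point x1.
have [lP dP] := orbit_rep lG ia ax.
have [_ _ [_ surj]] := hQ; have [v Ev] := surj _ _ _ _ lP w.
exists ('d (@slice_rep R) a v); rewrite -ax.
exact: etrans (esym (dP v)) Ev.
Qed.

Lemma to_quotient_diff_inj x (j : idx Q) G v :
  @local_rep R _ _ _ _ (disk R) Q (@to_quotient R) tt x j G ->
  'd G x v = 0 -> v = 0.
Proof.
move=> lG; rewrite diff_jacobian => /(congr1 (mulmx^~ (invmx ('J G x)))).
rewrite mul0mx mulmxK//; apply: surjective_unitmx => w.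
by have [u <-] := to_quotient_diff_surj lG w; exists u; rewrite diff_jacobian.
Qed.

Lemma to_quotient_diffeo : diffeo (disk R) Q (@to_quotient R).
Proof.
have [Qm ptsQ _] := hQ.
pose f' q := get [set x : 'rV[R]_2 | enorm x < pi / 2 /\ to_quotient x = q].
have f'P x : enorm x < pi / 2 -> enorm (f' (to_quotient x)) < pi / 2 /\
    to_quotient (f' (to_quotient x)) = to_quotient x.
  move=> x1; exact: (@getPex _ [set y : 'rV[R]_2 | enorm y < pi / 2 /\
    to_quotient y = to_quotient x] (ex_intro _ x (conj x1 erefl))).
apply: (@bijective_smooth_diffeo _ _ _ _ _ _ _ f') => //.
- exact: disk_manifold.
- exact: smooth_to_quotient.
- by move=> x /f'P[_ /to_quotient_inj].
- move=> q; rewrite ptsQ => -[p Dp <-]; rewrite orbit_slice /=.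
  by apply: f'P; rewrite enorm_rotation; case: Dp.
- by move=> [] a j F lF w; exact: to_quotient_diff_surj lF w.
Qed.

(** As d G is injective, G composed with the slice projection has the same
    vertical vectors as the slice projection. *)
Lemma horizontal_orbit_rep (i : idx D) a (j : idx Q) G v : dom i a ->
  @local_rep R _ _ _ _ (disk R) Q (@to_quotient R) tt (slice_rep a) j G ->
  (forall u, 'd G (slice_rep a) ('d (@slice_rep R) a u) = 0 ->
     inner gM i a u v = 0) <-> horizontal i a v.
Proof.
move=> ia lG; split=> H u.
  by move=> Eu; apply: H; rewrite Eu linear0.
by move=> /(to_quotient_diff_inj lG); exact: H.
Qed.

Lemma riemannian_submersion_of_preserves (q : metric Q) :
  preserves h q (@to_quotient R) -> riemannian_submersion gM q (act_orbit act).
Proof.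
move=> pq; have [Qm _ sub] := hQ; split=> // i a j P lP H v w Hv Hw.
have [Qch _ _ _ _] := Qm; have [ia jP EP] := local_rep_at lP.
have [_ x1 _] := local_rep_at (slice_proj_rep ia).
have EG : par j (P a) = to_quotient (slice_rep a).
  rewrite EP orbit_slice /=; congr to_quotient.
  by have [_ _ <-] := local_rep_at (slice_proj_rep ia).
have [G lG] := smooth_to_quotient.2 tt (slice_rep a) j (P a) x1 jP EG.
have [lGP dGP] := orbit_rep lG ia erefl.
have [E dE] := near_diff lP (local_rep_unique (Qch j).2 lP lGP).
have dPE u : 'd P a u = 'd G (slice_rep a) ('d (@slice_rep R) a u).
  exact: etrans (esym (dE u)) (dGP u).
have hor u : H u -> horizontal i a u.
  move=> Hu; apply/(horizontal_orbit_rep u ia lG) => z Ez; apply: Hu.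
  by rewrite dPE.
apply: etrans (eq_inner q j (esym E) (dPE v) (dPE w)) _.
apply: etrans (esym (pq _ _ _ _ lG _ _)) _.
exact: slice_horizontal_isometry ia (hor _ Hv) (hor _ Hw).
Qed.

Lemma preserves_of_riemannian_submersion (q : metric Q) :
  riemannian_submersion gM q (act_orbit act) -> preserves h q (@to_quotient R).
Proof.
move=> [_ rs] [] x j G lG v w; have [/= x1 _ _] := local_rep_at lG.
have [i [a [ia ax _]]] := slice_point x1; rewrite -ax in lG *.
have [lP dP] := orbit_rep lG ia erefl.
have [v' hv Ev] := slice_horizontal_lift v ia.
have [w' hw Ew] := slice_horizontal_lift w ia.
have H u : horizontal i a u -> forall z, 'd (G \o @slice_rep R) a z = 0 ->
    inner gM i a z u = 0.
  by move=> /(horizontal_orbit_rep u ia lG) Hu z; rewrite dP; exact: Hu.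
have := rs _ _ _ _ lP _ _ (H _ hv) (H _ hw).
rewrite -(slice_horizontal_isometry tt ia hv hw) => E.
have Ev' : 'd (G \o @slice_rep R) a v' = 'd G (slice_rep a) v by rewrite dP Ev.
have Ew' : 'd (G \o @slice_rep R) a w' = 'd G (slice_rep a) w by rewrite dP Ew.
apply: etrans (esym (eq_inner h tt erefl Ev Ew)) _.
apply: etrans (esym E) _; exact: eq_inner.
Qed.

End OrbitSpace.

Theorem is_Upsilon_tan_sin : is_Upsilon (rot_metric (@tan R)) h.
Proof.
split; first exact: orbit_space_exists.
move=> Q hQ; have dQ := to_quotient_diffeo hQ; have [Qm _ _] := hQ.
split=> //.
  have [|q [rq pq]] := @pushforward_metric R _ _ _ (disk R) h Q _ tt _ Qm riemannian_sin dQ.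
    by case.
  exists q; split=> //; exact: riemannian_submersion_of_preserves.
move=> q [_ rq rs]; split=> //; first exact: riemannian_sin.
exact: preserves_of_riemannian_submersion.
Qed.

End Upsilon.

(** * The upper hemisphere *)

Section Hemisphere.
Context {R : realType}.
Notation H := (hemisphere R).
Notation D := (disk R).
Notation h := (rot_metric (@sin R)).
Notation graph := (@par R 2 _ H tt).

Let oH : open [set u : 'rV[R]_2 | enorm u < 1].
Proof. exact: open_enorm_lt. Qed.

Let oD : open [set u : 'rV[R]_2 | enorm u < pi / 2].
Proof. exact: open_enorm_lt. Qed.

Lemma sqnorm_lt1 (u : 'rV[R]_2) : (enorm u < 1) = (sqnorm u < 1).
Proof. by rewrite -sqr_enorm expr_lt1// enorm_ge0. Qed.

Lemma smooth_graph : smooth_on [set u : 'rV[R]_2 | enorm u < 1] graph.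
Proof.
apply: smooth_row3 => //; try by smooth_tac.
have s : smooth_on [set u : 'rV[R]_2 | enorm u < 1] (fun u => 1 - sqnorm u).
  apply: smoothD => //; first exact: smooth_cst.
  by apply: smoothN => //; apply: smooth_sqnorm => //; exact: smooth_id.
have s2 : smooth_on [set u : 'rV[R]_2 | enorm u < 1]
    (fun u => Num.sqrt (1 - sqnorm u)).
  apply: (smooth_comp_real oH _ smooth_sqrt s) => u /=.
  by rewrite sqnorm_lt1 subr_gt0.
by apply: (eq_smooth oH _ s2) => u _; rewrite sqr_enorm.
Qed.

Lemma hemisphere_manifold : is_manifold H.
Proof.
apply: single_chart_manifold => //.
  move=> u v _ _ E; apply: row2P.
    by have := congr1 (fun y : 'rV[R]_3 => y 0 0) E; rewrite !mxE.
  by have := congr1 (fun y : 'rV[R]_3 => y 0 1) E; rewrite !mxE.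
have en (y : 'rV[R]_3) : enorm y = Num.sqrt (y 0 0 ^+ 2 + y 0 1 ^+ 2 + y 0 2 ^+ 2).
  by rewrite /enorm sum3.
apply/seteqP; split=> [y [y1 y2]|_ [u /= u1 <-]].
  pose u := row2 (y 0 0) (y 0 1).
  have E : sqnorm u = 1 - y 0 2 ^+ 2.
    have : enorm y ^+ 2 = 1 by rewrite y1 expr1n.
    rewrite en sqr_sqrtr ?addr_ge0 ?sqr_ge0// => <-.
    by rewrite /sqnorm row2E0 row2E1; ring.
  exists u.
    by rewrite /= sqnorm_lt1 E ltrBlDr ltrDl exprn_gt0.
  have [e0 e1 e2] := row3E (u 0 0) (u 0 1) (Num.sqrt (1 - enorm u ^+ 2)).
  apply: row3P; rewrite ?e0 ?e1 ?e2 ?row2E0 ?row2E1//.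
  by rewrite sqr_enorm E opprB addrC subrK sqrtr_sqr gtr0_norm.
rewrite en; have [-> -> ->] := row3E (u 0 0) (u 0 1) (Num.sqrt (1 - enorm u ^+ 2)).
have u2 : 0 < 1 - enorm u ^+ 2 by rewrite sqr_enorm subr_gt0 -sqnorm_lt1.
rewrite sqrtr_gt0 u2 (sqr_sqrtr (ltW u2)) sqr_enorm.
by split=> //; rewrite -[RHS]sqrtr1; congr Num.sqrt; rewrite /sqnorm; ring.
Qed.

Lemma inner_induced n k (M : manifold R n 'rV[R]_k) (i : idx M) a v w :
  inner (induced_metric M) i a v w =
  ('d (par i) a v *m ('d (par i) a w)^T) 0 0.
Proof.
have dJ u : 'd (par i) a u = u *m 'J (par i) a by exact: diff_jacobian.
have E := f_equal2 (fun y z : 'rV[R]_k => (y *m z^T) 0 0) (dJ v) (dJ w).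
apply: etrans (esym E); by rewrite /inner /induced_metric trmx_mul !mulmxA.
Qed.

Lemma riemannian_hemisphere : riemannian (induced_metric H).
Proof.
have dgraph a : enorm a < 1 -> differentiable graph a.
  by move=> a1; exact: smooth_differentiable smooth_graph a1.
split; first exact: hemisphere_manifold.
- move=> []; have sJ := smooth_jacobian oH smooth_graph.
  by move=> k; apply: Ck_mulmx => //; exact: Ck_trmx.
- by move=> i a _; rewrite /induced_metric trmx_mul trmxK.
- move=> [] a v a1 v0; rewrite inner_induced.
  have -> : ('d graph a v *m ('d graph a v)^T) 0 0 = \sum_k ('d graph a v) 0 k ^+ 2.
    by rewrite mxE; apply: eq_bigr => k _; rewrite mxE.
  rewrite lt0r sumr_ge0 ?andbT => [|k _]; last exact: sqr_ge0.
  rewrite sum3; apply: contra_neq v0 => E.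
  have dE (k : 'I_3) (l : 'I_2) : (fun x : 'rV[R]_2 => graph x 0 k) = (fun x => x 0 l) ->
      ('d graph a v) 0 k = v 0 l.
    move=> Ek; rewrite -deriveE; last exact: dgraph.
    by rewrite derive_mxE ?Ek ?derive_coord//; exact: dgraph.
  have d0 : ('d graph a v) 0 0 = v 0 0.
    by apply: dE; apply/funext => x; rewrite mxE.
  have d1 : ('d graph a v) 0 1 = v 0 1.
    by apply: dE; apply/funext => x; rewrite mxE.
  move: E; rewrite d0 d1 => /eqP.
  rewrite paddr_eq0 ?addr_ge0 ?sqr_ge0// => /andP[/eqP E _].
  by apply/eqP; rewrite -sqnorm_eq0; apply/eqP.
- apply: (preservesI hemisphere_manifold) => -[] a [] F lF.
  have [a1 _ _] := local_rep_at lF.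
  exists id; split; last by move=> v w; apply: eq_inner; rewrite ?diff_idE.
  exists [set u : 'rV[R]_2 | enorm u < 1]; split=> //.
  exact: smooth_id.
Qed.

(** In polar coordinates this is (rho, theta) |-> (sin rho cos theta, sin
    rho sin theta), the first two coordinates on the sphere. *)
Definition sphere_chart (x : 'rV[R]_2) : 'rV[R]_2 :=
  row2 (sinc_sqrt (sqnorm x) * x 0 0) (sinc_sqrt (sqnorm x) * x 0 1).

Definition to_sphere (x : 'rV[R]_2) : 'rV[R]_3 :=
  row3 (sinc_sqrt (sqnorm x) * x 0 0) (sinc_sqrt (sqnorm x) * x 0 1)
       (cos_sqrt (sqnorm x)).

Lemma cos_sqrt_enorm (x : 'rV[R]_2) : cos_sqrt (sqnorm x) = cos (enorm x).
Proof. by rewrite -sqr_enorm cos_sqrtE. Qed.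

Lemma sinc_sqrt_sqr (r : R) :
  r ^+ 2 * sinc_sqrt (r ^+ 2) ^+ 2 = 1 - cos_sqrt (r ^+ 2) ^+ 2.
Proof. by rewrite -exprMn sinc_sqrtE cos_sqrtE sin2cos2. Qed.

Lemma sinc_sqrt_neq0 (r : R) : 0 <= r < pi / 2 -> sinc_sqrt (r ^+ 2) != 0.
Proof.
move=> /andP[r0 r1]; have [->|r2] := eqVneq r 0.
  by rewrite expr0n /= sinc_sqrt0 oner_neq0.
have : sin r != 0 by apply: sin_neq0; rewrite lt0r r2 r0.
by rewrite -sinc_sqrtE; apply: contra_neq => ->; rewrite mulr0.
Qed.

Lemma sqnorm_sphere_chart x : sqnorm (sphere_chart x) = 1 - cos_sqrt (sqnorm x) ^+ 2.
Proof.
rewrite -[in RHS]sqr_enorm -sinc_sqrt_sqr sqr_enorm /sphere_chart.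
by rewrite {1}/sqnorm row2E0 row2E1 /sqnorm; ring.
Qed.

Lemma graph_sphere_chart x : enorm x < pi / 2 ->
  enorm (sphere_chart x) < 1 /\ graph (sphere_chart x) = to_sphere x.
Proof.
move=> x1; have c0 : 0 < cos_sqrt (sqnorm x).
  by rewrite cos_sqrt_enorm cos_gt0_quarter// enorm_ge0.
split; first by rewrite sqnorm_lt1 sqnorm_sphere_chart ltrBlDr ltrDl exprn_gt0.
rewrite /= /to_sphere sqr_enorm sqnorm_sphere_chart opprB addrC subrK.
by rewrite sqrtr_sqr gtr0_norm// row2E0 row2E1.
Qed.

Lemma smooth_sphere_chart (U : set 'rV[R]_2) : open U -> smooth_on U sphere_chart.
Proof.
move=> oU; have s : smooth_on U (fun x : 'rV[R]_2 => sinc_sqrt (sqnorm x)).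
  apply: (smooth_comp_real oU _ smooth_sinc_sqrt) => //.
  by apply: smooth_sqnorm => //; exact: smooth_id.
by rewrite /sphere_chart; smooth_tac.
Qed.

Lemma sphere_chart_rep a : enorm a < pi / 2 ->
  @local_rep R _ _ _ _ D H to_sphere tt a tt sphere_chart.
Proof.
move=> a1; exists [set x | enorm x < pi / 2]; split=> //.
  exact: smooth_sphere_chart.
by move=> x /graph_sphere_chart.
Qed.

Lemma smooth_to_sphere : smooth_map D H to_sphere.
Proof.
split=> [x /sphere_chart_rep /local_rep_at[_ + <-]|[] a [] b a1 _ _].
  by move=> ?; exact: (par_pts hemisphere_manifold).
by exists sphere_chart; exact: sphere_chart_rep.
Qed.

Let sinc' : R -> R := psum (pseries_diffs sin_sqrt_coeff).
Let cos' : R -> R := psum (pseries_diffs cos_sqrt_coeff).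

Let is_derive_sinc (u : R) : is_derive u 1 (@sinc_sqrt R) (sinc' u).
Proof. exact: is_derive_psum (@entire_sin_sqrt R). Qed.

Let is_derive_cos_sqrt (u : R) : is_derive u 1 (@cos_sqrt R) (cos' u).
Proof. exact: is_derive_psum (@entire_cos_sqrt R). Qed.

(** Differentiating cos_sqrt (r^2) = cos r and r sinc_sqrt (r^2) = sin r at
    r expresses both derivatives by the functions themselves. *)
Let derivative_relations (r : R) : r != 0 ->
  cos' (r ^+ 2) = - sinc_sqrt (r ^+ 2) / 2 /\
  sinc' (r ^+ 2) = (cos_sqrt (r ^+ 2) - sinc_sqrt (r ^+ 2)) / (2 * r ^+ 2).
Proof.
move=> r0.
have dsq : is_derive r 1 (fun x : R => x ^+ 2) (2 * r).
  have [d E] := is_deriveM (is_derive_id r (1 : R)) (is_derive_id r (1 : R)).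
  apply: (DeriveDef (df := 2 * r)) => //; apply: etrans E _.
  by rewrite /GRing.scale /=; ring.
have ddsq : differentiable (fun x : R => x ^+ 2) r.
  by apply/derivable1_diffP; case: dsq.
have [_ Ec] := is_derive_comp_real ddsq dsq (is_derive_cos_sqrt (r ^+ 2)).
have hs := is_derive_comp_real ddsq dsq (is_derive_sinc (r ^+ 2)).
have [_ Es] := is_deriveM (is_derive_id r (1 : R)) hs.
split.
  have : 2 * r * cos' (r ^+ 2) = - (r * sinc_sqrt (r ^+ 2)).
    rewrite -Ec sinc_sqrtE (_ : (fun x => _) = cos); last first.
      by apply/funext => x; rewrite cos_sqrtE.
    by have [_ ->] := is_derive_cos r.
  by move=> E; apply: (mulfI (_ : 2 * r != 0)); rewrite ?mulf_neq0// E; field.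
have : r * (2 * r * sinc' (r ^+ 2)) + sinc_sqrt (r ^+ 2) * 1 = cos_sqrt (r ^+ 2).
  apply: etrans (esym Es) _; rewrite cos_sqrtE.
  rewrite (_ : id * _ = sin); first by have [_ ->] := is_derive_sin r.
  by apply/funext => x; rewrite -[RHS]sinc_sqrtE.
by move=> <-; field.
Qed.

Lemma diff_to_sphere (a v : 'rV[R]_2) :
  differentiable to_sphere a /\
  'd to_sphere a v = row3
    (sinc_sqrt (sqnorm a) * v 0 0 + a 0 0 * (2 * dot a v * sinc' (sqnorm a)))
    (sinc_sqrt (sqnorm a) * v 0 1 + a 0 1 * (2 * dot a v * sinc' (sqnorm a)))
    (2 * dot a v * cos' (sqnorm a)).
Proof.
have oT := @openT 'rV[R]_2.
have ssq : smooth_on setT (@sqnorm R) by apply: smooth_sqnorm => //; exact: smooth_id.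
have s1 : smooth_on setT (fun x : 'rV[R]_2 => sinc_sqrt (sqnorm x)).
  exact: (smooth_comp_real oT _ smooth_sinc_sqrt).
have s2 : smooth_on setT (fun x : 'rV[R]_2 => cos_sqrt (sqnorm x)).
  exact: (smooth_comp_real oT _ smooth_cos_sqrt).
have sT : smooth_on setT to_sphere by apply: smooth_row3 => //; smooth_tac.
have dT : differentiable to_sphere a by exact: smooth_differentiable sT I.
split=> //.
have dsq : is_derive a v (@sqnorm R) (2 * dot a v).
  have c j := is_derive_coord a v 0 j.
  have [d E] := is_deriveD (is_deriveM (c 0) (c 0)) (is_deriveM (c 1) (c 1)).
  apply: (DeriveDef (df := 2 * dot a v)) => //; apply: etrans E _.
  by rewrite /GRing.scale /= /dot; ring.
have ddsq : differentiable (@sqnorm R) a by exact: smooth_differentiable ssq I.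
have hs := is_derive_comp_real ddsq dsq (is_derive_sinc _).
have [_ Ec] := is_derive_comp_real ddsq dsq (is_derive_cos_sqrt _).
have c j := is_derive_coord a v 0 j.
have [r0 r1 r2] := row3E
    (sinc_sqrt (sqnorm a) * v 0 0 + a 0 0 * (2 * dot a v * sinc' (sqnorm a)))
    (sinc_sqrt (sqnorm a) * v 0 1 + a 0 1 * (2 * dot a v * sinc' (sqnorm a)))
    (2 * dot a v * cos' (sqnorm a)).
rewrite -deriveE//; apply: row3P; rewrite derive_mxE// ?r0 ?r1 ?r2.
- rewrite (_ : (fun y => _) = fun x => sinc_sqrt (sqnorm x) * x 0 0); last first.
    by apply/funext => x; rewrite mxE.
  by have [_ E] := is_deriveM hs (c 0); exact: E.
- rewrite (_ : (fun y => _) = fun x => sinc_sqrt (sqnorm x) * x 0 1); last first.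
    by apply/funext => x; rewrite mxE.
  by have [_ E] := is_deriveM hs (c 1); exact: E.
- rewrite (_ : (fun y => _) = fun x => cos_sqrt (sqnorm x)); last first.
    by apply/funext => x; rewrite mxE.
  exact: Ec.
Qed.

(** The hemisphere chart followed by the graph parametrization is
    [to_sphere] on the disk. Its differential gives S^2 (v . w) + ((2 S (C -
    S) + (C - S)^2) / u + S^2) (x . v) (x . w), where C^2 + u S^2 = 1, and
    Lagrange's identity rewrites this as the metric of profile sin. *)
Lemma sphere_chart_isometry i j (a v w : 'rV[R]_2) : enorm a < pi / 2 ->
  inner h i a v w =
  inner (induced_metric H) j (sphere_chart a) ('d sphere_chart a v)
    ('d sphere_chart a w).
Proof.
move=> a1; rewrite inner_induced.
have dc : differentiable sphere_chart a.
  exact: smooth_differentiable (smooth_sphere_chart oD) a1.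
have dg : differentiable graph (sphere_chart a).
  by apply: smooth_differentiable smooth_graph _; exact: (graph_sphere_chart a1).1.
have E u : 'd graph (sphere_chart a) ('d sphere_chart a u) = 'd to_sphere a u.
  apply: etrans (esym (diff_compE u dc dg)) _.
  have near_eq : \forall x \near a, (graph \o sphere_chart) x = to_sphere x.
    by apply: (near_open oD a1) => x /graph_sphere_chart[].
  have [_ Ed] := near_eq_is_diff near_eq (differentiable_comp dc dg).
  exact: (congr1 (fun k : 'rV[R]_2 -> 'rV[R]_3 => k u) (esym Ed)).
apply: etrans (esym (f_equal2 (fun y z : 'rV[R]_3 => (y *m z^T) 0 0) (E v) (E w))).
rewrite (diff_to_sphere a v).2 (diff_to_sphere a w).2 mxE sum3 !mxE /=.
rewrite inner_rot_metric.
have [->|a0] := eqVneq a 0.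
  rewrite /dot /cross /sqnorm !mxE expr0n /= !(mul0r, addr0, mulr0, subr0).
  by rewrite sinc_sqrt0 !mul1r.
have s0 : sqnorm a != 0 by rewrite sqnorm_eq0.
have e0 : enorm a != 0 by rewrite enorm_eq0.
have [Ec Es] := derivative_relations e0; rewrite sqr_enorm in Ec Es.
have := sinc_sqrt_sqr (enorm a); rewrite sqr_enorm => SC.
rewrite Ec Es /rot_coef sqr_enorm.
have -> : sin (enorm a) ^+ 2 = sqnorm a * sinc_sqrt (sqnorm a) ^+ 2.
  by rewrite -sinc_sqrtE exprMn sqr_enorm.
have cc : cross a v * cross a w = sqnorm a * dot v w - dot a v * dot a w.
  by rewrite /cross /dot /sqnorm; ring.
rewrite cc; set S := sinc_sqrt _ in SC *; set C := cos_sqrt _ in SC *.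
have CE : C ^+ 2 = 1 - sqnorm a * S ^+ 2 by rewrite SC; ring.
have -> : (S * v 0 0 + a 0 0 * (2 * dot a v * ((C - S) / (2 * sqnorm a)))) *
   (S * w 0 0 + a 0 0 * (2 * dot a w * ((C - S) / (2 * sqnorm a)))) +
   (S * v 0 1 + a 0 1 * (2 * dot a v * ((C - S) / (2 * sqnorm a)))) *
   (S * w 0 1 + a 0 1 * (2 * dot a w * ((C - S) / (2 * sqnorm a)))) +
   2 * dot a v * (- S / 2) * (2 * dot a w * (- S / 2)) =
   S ^+ 2 * dot v w + dot a v * dot a w *
     ((2 * S * (C - S) + (C - S) ^+ 2) / sqnorm a + S ^+ 2).
  by move: s0; rewrite /dot /sqnorm => s0; field.
have -> : 2 * S * (C - S) + (C - S) ^+ 2 = C ^+ 2 - S ^+ 2 by ring.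
by rewrite CE; field.
Qed.

(** The point of height y_2 comes from the radius acos y_2, which is less
    than pi / 2 because y_2 is positive. *)
Lemma to_sphere_surj y : pts H y ->
  exists2 x : 'rV[R]_2, enorm x < pi / 2 & to_sphere x = y.
Proof.
move=> [y1 y2].
have E : y 0 0 ^+ 2 + y 0 1 ^+ 2 = 1 - y 0 2 ^+ 2.
  have : enorm y ^+ 2 = 1 by rewrite y1 expr1n.
  rewrite /enorm sqr_sqrtr; last by apply: sumr_ge0 => i _; exact: sqr_ge0.
  by rewrite sum3 => <-; ring.
have y3 : y 0 2 <= 1.
  have : y 0 2 ^+ 2 <= 1 by rewrite -subr_ge0 -E addr_ge0 ?sqr_ge0.
  by rewrite expr_le1//; exact: ltW y2.
have yI : -1 <= y 0 2 <= 1 by rewrite y3 andbT; lra.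
pose r := acos (y 0 2).
have cr : cos r = y 0 2 by rewrite acosK// in_itv.
have r0 : 0 <= r by exact: acos_ge0.
have pi0 := pi_gt0 R.
have r1 : r < pi / 2.
  have := @ltr_cos R r (pi / 2); rewrite !in_itv /= r0 acos_lepi// => <- //.
    by rewrite cr cos_pihalf.
  by apply/andP; split; lra.
have S0 : sinc_sqrt (r ^+ 2) != 0 by apply: sinc_sqrt_neq0; rewrite r0.
pose x := row2 (y 0 0 / sinc_sqrt (r ^+ 2)) (y 0 1 / sinc_sqrt (r ^+ 2)).
have xr : sqnorm x = r ^+ 2.
  have := sinc_sqrt_sqr r; rewrite cos_sqrtE cr -E => Er.
  rewrite /sqnorm row2E0 row2E1 !expr_div_n -mulrDl -Er mulfK//.
  by rewrite expf_neq0.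
exists x; first by rewrite enormE xr sqrtr_sqr ger0_norm.
have [e0 e1 e2] := row3E (sinc_sqrt (sqnorm x) * x 0 0)
  (sinc_sqrt (sqnorm x) * x 0 1) (cos_sqrt (sqnorm x)).
apply: row3P; rewrite ?e0 ?e1 ?e2 xr ?row2E0 ?row2E1.
- by rewrite mulrC divfK.
- by rewrite mulrC divfK.
- by rewrite cos_sqrtE cr.
Qed.

Lemma to_sphere_inj (x y : 'rV[R]_2) : enorm x < pi / 2 -> enorm y < pi / 2 ->
  to_sphere x = to_sphere y -> x = y.
Proof.
move=> x1 y1 E; have pi0 := pi_gt0 R.
have [a0 a1 a2] := row3E (sinc_sqrt (sqnorm x) * x 0 0)
  (sinc_sqrt (sqnorm x) * x 0 1) (cos_sqrt (sqnorm x)).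
have [b0 b1 b2] := row3E (sinc_sqrt (sqnorm y) * y 0 0)
  (sinc_sqrt (sqnorm y) * y 0 1) (cos_sqrt (sqnorm y)).
have Er : enorm x = enorm y.
  apply: cos_inj; rewrite ?in_itv /= ?enorm_ge0 //=; [lra|lra|].
  by rewrite -!cos_sqrt_enorm -a2 -b2 -/(to_sphere x) E.
have Es : sqnorm x = sqnorm y by rewrite -!sqr_enorm Er.
have S0 : sinc_sqrt (sqnorm y) != 0.
  by rewrite -sqr_enorm; apply: sinc_sqrt_neq0; rewrite enorm_ge0.
apply: row2P; apply: (mulfI S0).
  by rewrite -b0 -{1}Es -a0 -/(to_sphere x) E.
by rewrite -b1 -{1}Es -a1 -/(to_sphere x) E.
Qed.

(** Injectivity of the differential comes for free: a vector killed by it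
    has length zero in a Riemannian metric. *)
Theorem riem_isometry_to_sphere : riem_isometry h (induced_metric H) to_sphere.
Proof.
have Hm := hemisphere_manifold; have [Hch _ _ _ _] := Hm.
have rep a F : @local_rep R _ _ _ _ D H to_sphere tt a tt F ->
    enorm a < pi / 2 /\ forall v, 'd sphere_chart a v = 'd F a v.
  move=> lF; have [a1 _ _] := local_rep_at lF; split; first exact: a1.
  exact: (near_diff lF (local_rep_unique (Hch tt).2 lF (sphere_chart_rep a1))).2.
split; first exact: riemannian_sin.
- exact: riemannian_hemisphere.
- pose f' y := get [set x : 'rV[R]_2 | enorm x < pi / 2 /\ to_sphere x = y].
  have f'P y : pts H y -> enorm (f' y) < pi / 2 /\ to_sphere (f' y) = y.
    move=> /to_sphere_surj[x x1 Ex].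
    exact: (@getPex _ [set x : 'rV[R]_2 | enorm x < pi / 2 /\ to_sphere x = y]
      (ex_intro _ x (conj x1 Ex))).
  apply: (@bijective_smooth_diffeo _ _ _ _ D H to_sphere f') => //.
  + exact: disk_manifold.
  + exact: smooth_to_sphere.
  + move=> x x1; have [z1 Ez] := f'P _ (smooth_to_sphere.1 _ x1).
    exact: to_sphere_inj.
  + move=> [] a [] F /rep[a1 dE] w.
    have J1 : 'J sphere_chart a \in unitmx.
      apply: injective_unitmx => v; rewrite -diff_jacobian => v0.
      apply/eqP; apply: contraT => vn0.
      have [_ _ _ posh _] := riemannian_sin (R := R).
      have := posh tt a v a1 vn0; rewrite (sphere_chart_isometry tt tt v v a1).
      rewrite (eq_inner (induced_metric H) tt erefl v0 v0).
      by rewrite /inner !mul0mx mxE ltxx.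
    exists (w *m invmx ('J sphere_chart a)).
    by rewrite -dE diff_jacobian mulmxKV.
- apply: (preservesI Hm) => -[] a [] F /rep[a1 _].
  exists sphere_chart; split; first exact: sphere_chart_rep.
  by move=> v w; exact: sphere_chart_isometry.
Qed.

Lemma to_sphere_polar (rho theta : R) : to_sphere (polar rho theta) =
  row3 (sin rho * cos theta) (sin rho * sin theta) (cos rho).
Proof.
have E : sqnorm (polar rho theta) = rho ^+ 2.
  rewrite /sqnorm row2E0 row2E1 !exprMn -mulrDr cos2Dsin2 mulr1 //.
rewrite /to_sphere E row2E0 row2E1 cos_sqrtE -(sinc_sqrtE rho).
by congr row3; ring.
Qed.

End Hemisphere.

(** * The theorem *)

Theorem mainTheorem2 (R : realType) :
  let g : metric (disk R) := rot_metric (@tan R) in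
  let h : metric (disk R) := rot_metric (@sin R) in
  let gM : metric (disk_circle R) := prod_metric g (circle_metric (1 : R)) in
  [/\ riemannian g,
      free_isometric_action gM (@diag_action R),
      is_Upsilon g h &
      exists F : 'rV[R]_2 -> 'rV[R]_3,
        riem_isometry h (induced_metric (hemisphere R)) F /\
        forall rho theta : R, 0 <= rho < pi / 2 ->
          F (polar rho theta) =
          row3 (sin rho * cos theta) (sin rho * sin theta) (cos rho)].
Proof.
split.
- exact: riemannian_tan.
- exact: diag_action_free_isometric tan_profile (@tan_neq0 R).
- exact: is_Upsilon_tan_sin.
- exists to_sphere; split; first exact: riem_isometry_to_sphere.
  by move=> rho theta _; exact: to_sphere_polar.
Qed.
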